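(* Let $\Gamma$ be any chain of $g$ cycles, with torsion profile $\underline{m}=(m_2,\dots,m_g)$ and marked point $w=w_g$ on the rightmost cycle, and let $\lambda$ be any partition. Then $$W^\lambda(\Gamma,w)=\bigcup_{t\vdash_{\underline{m}}\lambda}\mathbf{T}(t),$$ the union being over all $\underline{m}$-displacement tableaux $t$ on $\lambda$.
   Context: A chain of $g$ cycles is a metric graph $\Gamma$ of genus $g$ formed from $g$ cycles (circles), the $i$th of length $\ell_i>0$ with two distinct points $v_i\neq w_i$ on it, where for $1\le i<g$ the point $w_i$ is joined to $v_{i+1}$ by a bridge (an edge of arbitrary length $\geq 0$; length $0$ means $w_i$ and $v_{i+1}$ are identified). Edge lengths are arbitrary. The marked point is $w_g$. Fix a clockwise orientation on each cycle and let $\ell(v_iw_i)$ be the length of the clockwise edge from $v_i$ to $w_i$. The $i$th torsion order $m_i$ ($1\le i\le g$) is $0$ if $\ell(v_iw_i)$ is an irrational multiple of $\ell_i$; otherwise $m_i$ is the minimum positive integer such that $m_i\cdot\ell(v_iw_i)$ is an integer multiple of $\ell_i$. The torsion profile is $\underline{m}=(m_2,\dots,m_g)$. For $\xi\in\mathbf{R}$, $\langle\xi\rangle_i$ denotes the point on the $i$th cycle located $\xi\cdot\ell(v_iw_i)$ units clockwise from $w_i$. A partition is a finite non-increasing sequence $\lambda=(\lambda_0,\dots,\lambda_r)$ of nonnegative integers (up to trailing zeros), identified with the subset $\{(x,y)\in\mathbf{Z}_{>0}^2: 1\le x\le\lambda_{y-1},\ 1\le y\le r+1\}$, whose elements are called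 boxes. For a metric graph $\Gamma$ of genus $g$, $w\in\Gamma$ and a partition $\lambda$, $W^\lambda(\Gamma,w)=\{[D]\in\mathrm{Pic}^0(\Gamma): r(D+d'\cdot w)\ge r' \text{ whenever } (g-d'+r',\,r'+1)\in\lambda\}$, where $r(\cdot)$ is the Baker-Norine rank and $d',r'$ range over the integers. An $\underline{m}$-displacement tableau on $\lambda$, written $t\vdash_{\underline{m}}\lambda$, is a function $t:\lambda\to\{1,\dots,g\}$ such that (1) $t$ is strictly increasing in every row and every column of $\lambda$; (2) whenever $(x,y)\ne(x',y')$ are boxes of $\lambda$ with $t(x,y)=t(x',y')$, one has $x-y\equiv x'-y'\pmod{m_{t(x,y)}}$ (congruence modulo $0$ means equality; by (1) the label $1$ cannot repeat, so $m_1$ is never used). For such $t$, $\mathbf{T}(t)\subseteq\mathrm{Pic}^0(\Gamma)$ is the set of divisor classes of the form $\sum_{i=1}^g\langle\xi_i\rangle_i-g\cdot w_g$, where $\xi_1,\dots,\xi_g$ are real numbers such that $\xi_{t(x,y)}\equiv x-y \pmod{m_{t(x,y)}}$ for all $(x,y)\in\lambda$. *)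

(* Defs.v *)
From HB Require Import structures.
From mathcomp Require Import freeg.
From mathcomp Require Import all_boot all_order all_algebra.
From mathcomp Require Import all_classical all_reals.

Set Implicit Arguments.
Unset Strict Implicit.
Unset Printing Implicit Defensive.

Import Order.TTheory GRing.Theory Num.Theory.
Local Open Scope classical_set_scope.
Local Open Scope ring_scope.

(* A metric graph is given by a finite model: loops and multiple edges are
   allowed, and the orientation of an edge only serves to parametrize it by
   [0, len e], with 0 at src e and len e at tgt e. *)
Record mgraph (R : realType) := MGraph {
  vertex : finType;
  edge : finType;
  src : edge -> vertex;
  tgt : edge -> vertex;
  len : edge -> R;
  len_gt0 : forall e, 0 < len e
}.

Section MetricGraph.
Context (R : realType) (G : mgraph R).

(* The first Betti number; the formula assumes that G is connected. *)
Definition genus : int := #|edge G|%:Z - #|vertex G|%:Z + 1.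

(* A point is a vertex, or lies in the interior of an edge. *)
Definition gpoint : Type :=
  (vertex G + {x : edge G * R | 0 < x.2 < len x.1})%type.
HB.instance Definition _ := Choice.on gpoint.

Definition epoint (e : edge G) (s : R) : gpoint :=
  if insub (e, s) is Some x then inr x
  else if s <= 0 then inl (src e) else inl (tgt e).

Definition piecewise_linear (l : R) (F : R -> R) : Prop :=
  exists ts : seq R,
    [/\ path <%R 0 ts, last 0 ts = l &
      forall i, (i < size ts)%N -> exists m : int,
        let a := nth 0 (0 :: ts) i in
        forall s, a <= s <= nth 0 ts i -> F s = F a + m%:~R * (s - a)].

Definition rational_function (f : gpoint -> R) : Prop :=
  forall e : edge G, piecewise_linear (len e) (fun s => f (epoint e s)).

(* The slope of F at 0+, for F linear with integer slope near 0+. *)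
Definition slope (F : R -> R) : int :=
  xget 0 [set m : int | exists2 eps : R, 0 < eps &
    forall h, 0 <= h <= eps -> F h = F 0 + m%:~R * h].

(* The sum of the outgoing slopes of f at p; a loop has two tangent directions
   at its vertex. *)
Definition ord_at (f : gpoint -> R) (p : gpoint) : int :=
  match p with
  | inl v =>
      \sum_(e | src e == v) slope (fun h => f (epoint e h)) +
      \sum_(e | tgt e == v) slope (fun h => f (epoint e (len e - h)))
  | inr x =>
      let: (e, s) := val x in
      slope (fun h => f (epoint e (s + h))) +
      slope (fun h => f (epoint e (s - h)))
  end.

Definition divisor : Type := {freeg gpoint / int}.
HB.instance Definition _ := GRing.Zmodule.on divisor.

Definition effective (D : divisor) : Prop := forall p, 0 <= coeff p D.

Definition lin_equiv (D D' : divisor) : Prop :=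
  exists2 f, rational_function f & forall p, coeff p (D - D') = ord_at f p.

Definition rank_geq (D : divisor) (k : int) : Prop :=
  forall E, effective E -> deg E = k ->
    exists2 D', effective D' & lin_equiv (D - E) D'.

(* rank_geq D k holds for every k < 0, and fails for k > max(deg D, -1). *)
Definition bn_rank (D : divisor) : int :=
  xget (-1) [set k | rank_geq D k /\ forall j, rank_geq D j -> j <= k].

(* Elements of Pic(G) are represented as equivalence classes of divisors. *)
Definition div_class (D : divisor) : set divisor := [set D' | lin_equiv D D'].

End MetricGraph.

Definition is_partition (la : seq nat) : Prop := sorted geq la.

Definition in_boxes (la : seq nat) (x y : int) : bool :=
  [&& 1 <= y, y <= (size la)%:Z, 1 <= x & x <= (nth 0%N la `|y - 1|%N)%:Z].

Definition Wset (R : realType) (G : mgraph R) (w : gpoint G) (la : seq nat) :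
    set (set (divisor G)) :=
  [set div_class D | D in [set D : divisor G | deg D = 0 /\
    forall d' r' : int, in_boxes la (genus G - d' + r') (r' + 1) ->
      r' <= bn_rank (D + << d' *g w >>)]].

(* The parameters of a chain of n.+1 cycles, the cycle of index i : 'I_n.+1
   being the (i+1)-st one: its length, the length of its clockwise edge from
   v to w, and the length of the bridge leaving it if it is not the last. *)
Record chain (R : realType) (n : nat) := Chain {
  cycle_len : 'I_n.+1 -> R;
  arc_len : 'I_n.+1 -> R;
  bridge_len : 'I_n -> R;
  arc_len_gt0 : forall i, 0 < arc_len i;
  arc_len_lt : forall i, arc_len i < cycle_len i;
  bridge_len_ge0 : forall j, 0 <= bridge_len j
}.

Section Chain.
Context (R : realType) (n : nat) (C : chain R n).

(* v_i coincides with w_(i-1), the bridge between them having length 0. *)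
Definition glued (i : 'I_n.+1) : bool :=
  if unlift ord0 i is Some j then bridge_len C j == 0 else false.

(* inl i is w_i, and inr i is v_i when it is not glued to w_(i-1). *)
Definition chain_vertex : Type := ('I_n.+1 + {i : 'I_n.+1 | ~~ glued i})%type.
HB.instance Definition _ := Finite.on chain_vertex.

Definition w_vertex (i : 'I_n.+1) : chain_vertex := inl i.

Definition v_vertex (i : 'I_n.+1) : chain_vertex :=
  if insub i is Some j then inr j else inl (inord i.-1).

(* inl (i, true) is the clockwise edge from v_i to w_i, inl (i, false) the
   clockwise edge from w_i to v_i, and inr j a bridge of positive length. *)
Definition chain_edge : Type :=
  ('I_n.+1 * bool + {j : 'I_n | 0 < bridge_len C j})%type.
HB.instance Definition _ := Finite.on chain_edge.

Definition chain_src (e : chain_edge) : chain_vertex :=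
  match e with
  | inl (i, true) => v_vertex i
  | inl (i, false) => w_vertex i
  | inr j => w_vertex (lift ord_max (val j))
  end.

Definition chain_tgt (e : chain_edge) : chain_vertex :=
  match e with
  | inl (i, true) => w_vertex i
  | inl (i, false) => v_vertex i
  | inr j => v_vertex (lift ord0 (val j))
  end.

Definition chain_len (e : chain_edge) : R :=
  match e with
  | inl (i, true) => arc_len C i
  | inl (i, false) => cycle_len C i - arc_len C i
  | inr j => bridge_len C (val j)
  end.

Lemma chain_len_gt0 e : 0 < chain_len e.
Proof.
case: e => [[i []]|[j bj]] //=; first exact: arc_len_gt0.
by rewrite subr_gt0 arc_len_lt.
Qed.

Definition chain_graph : mgraph R := MGraph chain_src chain_tgt chain_len_gt0.

Definition marked_point : gpoint chain_graph := inl (w_vertex ord_max).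

Definition torsion_order (i : 'I_n.+1) : nat :=
  let a := arc_len C i in
  let l := cycle_len C i in
  let multiple k := exists z : int, k%:R * a = z%:~R * l in
  if `[< exists q : rat, a = ratr q * l >] then
    xget 0%N [set m | [/\ (0 < m)%N, multiple m &
      forall k, (0 < k)%N -> multiple k -> (m <= k)%N]]
  else 0%N.

(* The point of the i-th cycle located s units clockwise from w_i. *)
Definition cycle_point (i : 'I_n.+1) (s : R) : gpoint chain_graph :=
  let l := cycle_len C i in
  let a := arc_len C i in
  let s0 := s - (Num.floor (s / l))%:~R * l in
  if s0 <= l - a then @epoint R chain_graph (inl (i, false)) s0
  else @epoint R chain_graph (inl (i, true)) (s0 - (l - a)).

Definition coord_point (i : 'I_n.+1) (xi : R) : gpoint chain_graph :=
  cycle_point i (xi * arc_len C i).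

(* Only the values of t on the boxes of la matter. *)
Definition displacement_tableau (la : seq nat) (t : int -> int -> 'I_n.+1) :
    Prop :=
  [/\ forall x x' y, in_boxes la x y -> in_boxes la x' y -> x < x' ->
        (t x y < t x' y)%N,
      forall x y y', in_boxes la x y -> in_boxes la x y' -> y < y' ->
        (t x y < t x y')%N &
      forall x y x' y', in_boxes la x y -> in_boxes la x' y' ->
        (x, y) <> (x', y') -> t x y = t x' y' ->
        (x - y = x' - y' %[mod (torsion_order (t x y))%:Z])%Z].

Definition Tset (la : seq nat) (t : int -> int -> 'I_n.+1) :
    set (set (divisor chain_graph)) :=
  [set div_class (\sum_i << coord_point i (xi i) >> -
                  << (n.+1)%:Z *g marked_point >>) | xi in
    [set xi : 'I_n.+1 -> R | forall x y, in_boxes la x y ->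
      exists k : int, xi (t x y) =
        (x - y)%:~R + k%:~R * (torsion_order (t x y))%:R]].

End Chain.

Arguments torsion_order {R n} C i.
Arguments coord_point {R n} C i xi.
Arguments displacement_tableau {R n} C la t.
Arguments Tset {R n} C la t.

(* Main.v *)
From HB Require Import structures.
Require Import Defs.
From mathcomp Require Import freeg.
From mathcomp Require Import all_boot all_order all_algebra.
From mathcomp Require Import all_classical all_reals.
From mathcomp Require Import ring lra zify.

(** Linear equivalence on a chain of cycles is governed by finitely many
    numbers. Retract the chain onto its [i]-th cycle, measure clockwise from
    [w_i], and add up the coordinates of the points of a divisor [D]: this is
    [cycle_weight i D], read modulo the length [l_i] of the cycle. Two divisors
    are equivalent if and only if they have the same degree and congruent
    weights on every cycle ([lin_equivP]). In one direction, a piecewise linear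
    function is a sum of hinges [s |-> max(0, s - c)], which turns the weight of
    a principal divisor into a telescoping sum; in the other direction the
    required function is written down as a sum of hinges placed at the
    retractions of the points of [D].

    From there on the graph disappears. A point on the [k]-th cycle has
    coordinate [0] on the cycles to its left, [- a_i] (the point [v_i]) on the
    cycles to its right, and an arbitrary coordinate on its own cycle. Hence [D]
    is equivalent to an effective divisor if and only if one can put chips on
    the cycles from left to right, at most [deg D] in total, leaving the [i]-th
    cycle empty only when the weight there is [- a_i] times the number of chips
    already placed. Putting a chip only when forced is optimal ([greedy],
    [lin_equiv_effectiveP]).

    For the rank, an opponent first removes [r] points. Fix the weights, keep only
    the first [i] cycles, and let the degree [d] and the number [r] vary: the
    question whether the greedy player survives every removal is recorded at the
    box [(x, y) = (i - d + r, r + 1)]. Going from [i] to [i + 1] cycles adds exactly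
    the boxes [(x, y)] whose neighbours [(x - 1, y)] and [(x, y - 1)] are already
    there and whose diagonal [x - y] is one of those singled out by the weight on
    the new cycle. This recursion is the definition of [rank_boxes], and
    [rank_boxesP] and [rank_geqP] justify it. So a class satisfies the rank
    conditions of a partition when every box of the partition is reached by this
    growth process, which starts from the empty partition.

    A displacement tableau is a record of such a growth: [t x y] is the step at
    which the box [(x, y)] may be added. Rows and columns increase because the
    neighbours of a box must come strictly before it, and boxes added at the same
    step lie on diagonals that agree modulo the torsion order. Conversely the
    labels of a tableau say, by induction, that every box has appeared by the
    step that it names. *)

Set Implicit Arguments.
Unset Strict Implicit.
Unset Printing Implicit Defensive.

Import Order.TTheory GRing.Theory Num.Theory.
Local Open Scope classical_set_scope.
Local Open Scope ring_scope.

(** * Piecewise linear functions as sums of hinges *)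

Section Hinges.
Context {R : realType}.
Implicit Types (h : seq (int * R)) (a c l s : R).

Definition hinge_sum h s : R :=
  \sum_(u <- h) u.1%:~R * Num.max 0 (s - u.2).

Lemma hinge_sum_cons n c h s :
  hinge_sum ((n, c) :: h) s = n%:~R * Num.max 0 (s - c) + hinge_sum h s.
Proof. by rewrite /hinge_sum big_cons. Qed.

Lemma hinge_sum_eq0 h s : {in h, forall u, s <= u.2} -> hinge_sum h s = 0.
Proof.
move=> hs; rewrite /hinge_sum big1_seq // => u /andP[_ /hs su].
by rewrite max_l ?mulr0// subr_le0.
Qed.

(** Each breakpoint contributes a hinge weighted by the change of slope there.
    Going through the pieces from the right, the hinges of the remaining pieces
    vanish on the current one, so only the first slope has to be corrected. *)
Lemma piecewise_linear_hinge_sum l (F : R -> R) : piecewise_linear l F ->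
  exists2 h, {in h, forall u, 0 <= u.2 <= l} &
    forall s, 0 <= s <= l -> F s = F 0 + hinge_sum h s.
Proof.
(* The left end of the interval is generalized for the induction on pieces. *)
case=> ts [+ <-]; have : exists a : R, a = 0 by exists 0.
case=> a a0; rewrite -[in X in X -> _]a0 -[in X in _ -> X]a0; move: {a0} a.
elim: ts => [|b ts IH] a /= => [_ _|/andP[ab tsP] F_lin].
  exists [::] => // s; rewrite -eq_le => /eqP <-.
  by rewrite hinge_sum_eq0 ?addr0.
have [i its|h h_ge hF] := IH b tsP.
  have [m mP] := F_lin i.+1 its; exists m; move: mP => /=.
  by case: i its => [|i] its //=; rewrite !(set_nth_default a) // ltnW.
have [m /= mF] := F_lin 0%N isT.
have b_last : b <= last b ts.
  have := order_path_min (@lt_trans _ _) tsP.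
  by case/lastP: ts {IH F_lin tsP hF h_ge} => [|ts x] //;
    rewrite all_rcons last_rcons => /andP[/ltW].
(* The slope m is switched on at a and off at b. *)
exists ((m, a) :: (- m, b) :: h).
  move=> u; rewrite !inE => /or3P[/eqP -> /=|/eqP -> /=|/h_ge /andP[bu ->]].
  - by rewrite lexx (le_trans (ltW ab)).
  - by rewrite b_last ltW.
  - by rewrite (le_trans (ltW ab)).
move=> s /andP[sa sl]; rewrite !hinge_sum_cons max_r ?subr_ge0//.
case: (leP s b) => sb.
  rewrite mF ?sa// max_l ?subr_le0// mulr0 hinge_sum_eq0 ?addr0 ?add0r//.
  by move=> u /h_ge/andP[bu _]; rewrite (le_trans sb).
rewrite hF ?(ltW sb)// (mF b) ?lexx ?ltW// max_r ?subr_ge0 ?ltW// mulrNz.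
by ring.
Qed.

(** The hinge points, sorted, cut [0, l] into intervals on which every hinge is
    either zero or of slope one. *)
Lemma hinge_sum_piecewise_linear l (F : R -> R) c0 h : 0 < l ->
  (forall s, 0 <= s <= l -> F s = c0 + hinge_sum h s) -> piecewise_linear l F.
Proof.
move=> l0 hF.
pose cs := [seq c <- [seq u.2 | u <- h] | 0 < c < l].
pose ts := sort <=%R (undup cs).
have ts_mem : ts =i cs by move=> c; rewrite mem_sort mem_undup.
have ts_bnd c : c \in ts -> 0 < c < l by rewrite ts_mem mem_filter => /andP[].
have tsP : path <%R 0 (rcons ts l).
  rewrite rcons_path path_min_sorted; last by apply/allP => c /ts_bnd/andP[].
  rewrite sort_lt_sorted undup_uniq /=.
  by have := mem_last 0 ts; rewrite inE => /predU1P[->|/ts_bnd/andP[]].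
have ltsP : sorted <=%R (0 :: rcons ts l).
  by apply: sub_path tsP => x y /ltW.
have nth_mono := sorted_leq_nth le_trans (@lexx _ R) 0 ltsP.
have nth_bnd i : (i <= size (rcons ts l))%N ->
    0 <= nth 0 (0 :: rcons ts l) i <= l.
  move=> il; have : nth 0 (0 :: rcons ts l) i \in 0 :: rcons ts l.
    exact: mem_nth.
  rewrite inE mem_rcons inE => /or3P[/eqP ->|/eqP ->|/ts_bnd/andP[/ltW -> /ltW->]//].
  - by rewrite lexx ltW.
  - by rewrite lexx ltW.
exists (rcons ts l); split; rewrite ?last_rcons// => i its.
set a := nth 0 (0 :: _) i; set b := nth 0 (rcons ts l) i.
have := nth_bnd i (ltnW its); have := nth_bnd i.+1 its; rewrite -/a /= -/b.
move=> /andP[b0 bl] /andP[a0 al].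
have cut u : u \in h -> (u.2 <= a) || (b <= u.2).
  move=> uh; case: (leP u.2 0) => [u0|u0]; first by rewrite (le_trans u0).
  case: (ltP u.2 l) => [ul|ul]; last by rewrite orbC (le_trans bl).
  have u_ts : u.2 \in rcons ts l.
    by rewrite mem_rcons inE ts_mem mem_filter u0 ul map_f ?orbT.
  have := index_mem u.2 (rcons ts l); rewrite u_ts => jts.
  have uE := nth_index 0 u_ts; case: (ltnP (index u.2 (rcons ts l)) i) => ij.
    by rewrite -uE (nth_mono (index u.2 (rcons ts l)).+1 i) ?inE //= ?ltnS// ltnW.
  by rewrite orbC -uE (nth_mono i.+1 (index u.2 (rcons ts l)).+1) ?inE.
(* Hinges before the interval have slope one on it, the others vanish. *)
exists (\sum_(u <- h | u.2 <= a) u.1) => s /andP[sa sb].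
rewrite !hF ?a0 ?al ?(le_trans a0) ?(le_trans sb)//.
rewrite -addrA; congr (_ + _).
rewrite rmorph_sum /= big_mkcond /= mulr_suml -big_split /=.
apply: eq_big_seq => u /cut; case: (leP u.2 a) => [ua _|au /= bu].
  by rewrite !max_r ?subr_ge0 ?(le_trans ua)//; ring.
by rewrite !max_l ?subr_le0 ?(ltW au) ?(le_trans sb)// mul0r !mulr0 addr0.
Qed.

Lemma hinge_sum0 h : {in h, forall u, 0 <= u.2} -> hinge_sum h 0 = 0.
Proof. exact: hinge_sum_eq0. Qed.

Lemma slope_eq (F : R -> R) (m : int) (eps : R) : 0 < eps ->
  (forall x, 0 <= x <= eps -> F x = F 0 + m%:~R * x) -> slope F = m.
Proof.
move=> eps0 Fm; apply: xget_unique; first by exists eps.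
move=> k [eps' eps'0 Fk]; pose d := Num.min eps eps'.
have d0 : 0 < d by rewrite lt_min eps0.
have := Fk d; have := Fm d; rewrite !ge_min !lexx orbT (ltW d0) => -> // /(_ isT).
by move/addrI/(mulIf (lt0r_neq0 d0))/intr_inj.
Qed.

Lemma hinge_sum_near h s : exists2 eps : R, 0 < eps &
  {in h, forall u, u.2 != s -> eps <= `|s - u.2|}.
Proof.
elim: h => [|v h [eps eps0 IH]]; first by exists 1.
have [vs|vs] := eqVneq v.2 s.
  by exists eps => // u; rewrite inE => /predU1P[->|/IH//]; rewrite vs eqxx.
exists (Num.min eps `|s - v.2|).
  by rewrite lt_min eps0 normr_gt0 subr_eq0 eq_sym.
move=> u; rewrite inE => /predU1P[-> _|uh us]; first by rewrite ge_min lexx orbT.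
by rewrite ge_min IH.
Qed.

(** Only the hinges at or before [s] have started to grow just after [s]; the
    next lemma is the mirror statement, where a hinge at [s] itself is still flat. *)
Lemma slope_hinge_sum_right l (F : R -> R) c0 h s : 0 <= s < l ->
  (forall x, 0 <= x <= l -> F x = c0 + hinge_sum h x) ->
  slope (fun x => F (s + x)) = \sum_(u <- h) u.1 * (u.2 <= s)%R%:R.
Proof.
move=> /andP[s0 sl] hF; have [eps eps0 far] := hinge_sum_near h s.
have m0 : 0 < Num.min eps (l - s) by rewrite lt_min eps0 subr_gt0.
apply: (slope_eq m0) => x; rewrite le_min addr0 => /and3P[x0 xe xl].
rewrite !hF; [|by rewrite s0 ltW|by apply/andP; split; lra].
rewrite -addrA; congr (_ + _).
rewrite rmorph_sum /= mulr_suml -big_split /=; apply: eq_big_seq => u /far.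
case: (leP u.2 s) => us + /=.
  move=> _; rewrite !max_r ?subr_ge0//; first by rewrite mulr1; ring.
  by rewrite (le_trans us)// lerDl.
rewrite gt_eqF// distrC ger0_norm ?subr_ge0 ?(ltW us)// => /(_ isT) exs.
by rewrite !max_l ?mulr0 ?mul0r ?addr0//; lra.
Qed.

Lemma slope_hinge_sum_left l (F : R -> R) c0 h s : 0 < s <= l ->
  (forall x, 0 <= x <= l -> F x = c0 + hinge_sum h x) ->
  slope (fun x => F (s - x)) = - \sum_(u <- h) u.1 * (u.2 < s)%R%:R.
Proof.
move=> /andP[s0 sl] hF; have [eps eps0 far] := hinge_sum_near h s.
have m0 : 0 < Num.min eps s by rewrite lt_min eps0.
apply: (slope_eq m0) => x; rewrite le_min subr0 => /and3P[x0 xe xs].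
rewrite !hF; [|by rewrite sl ltW|by apply/andP; split; lra].
rewrite -addrA; congr (_ + _).
rewrite rmorphN rmorph_sum /= mulNr mulr_suml -sumrB /=; apply: eq_big_seq => u /far.
case: (ltP u.2 s) => us + /=.
  rewrite lt_eqF// ger0_norm ?subr_ge0 ?(ltW us)// => /(_ isT) exs.
  by rewrite !max_r ?mulr1 ?subr_ge0//; [ring|lra|lra].
by move=> _; rewrite !max_l ?mulr0 ?mul0r ?subr0 //; lra.
Qed.
End Hinges.

(** * Principal divisors on a metric graph *)

Section GraphDivisors.
Context {R : realType} {G : mgraph R}.
Implicit Types (f : gpoint G -> R) (e : edge G) (s : R) (p : gpoint G).
Implicit Types (h : edge G -> seq (int * R)) (D E : divisor G).

Lemma epoint0 e : epoint e 0 = inl (src e).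
Proof. by rewrite /epoint insubF /= ?ltxx ?lexx. Qed.

Lemma epoint_len e : epoint e (len e) = inl (tgt e).
Proof. by rewrite /epoint insubF /= ?ltxx ?andbF// leNgt len_gt0. Qed.

Lemma epoint_inner e s (es : 0 < s < len e) :
  epoint e s = inr (exist _ (e, s) es).
Proof.
rewrite /epoint; case: insubP => [x _ xE|]; last by rewrite /= es.
by congr inr; apply: val_inj.
Qed.

Lemma epoint_eq_inl e s v : 0 <= s <= len e ->
  (epoint e s == inl v) =
    (s == 0) && (src e == v) || (s == len e) && (tgt e == v).
Proof.
case/andP; rewrite le_eqVlt => /predU1P[<- _|s0].
  by rewrite epoint0 eqxx (lt_eqF (len_gt0 e)) orbF.
rewrite le_eqVlt => /predU1P[->|sl].
  by rewrite epoint_len (gt_eqF (len_gt0 e)) eqxx.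
by rewrite epoint_inner ?s0// => sP; rewrite (gt_eqF s0) (lt_eqF sl).
Qed.

Lemma epoint_eq_inr e s (x : {x : edge G * R | 0 < x.2 < len x.1}) :
  0 <= s <= len e -> (epoint e s == inr x) = ((val x).1 == e) && ((val x).2 == s).
Proof.
case/andP; rewrite le_eqVlt => /predU1P[<- _|s0].
  rewrite epoint0; case: x => -[e' s'] /= xP; apply/esym/negbTE/nandP; right.
  by case/andP: xP => /gt_eqF ->.
rewrite le_eqVlt => /predU1P[->|sl].
  rewrite epoint_len; case: x => -[e' s'] /= xP; apply/esym/negbTE/andP.
  by case=> /eqP eE /eqP sE; move: xP; rewrite eE sE ltxx andbF.
by rewrite epoint_inner ?s0.
Qed.

(** Along an edge, the hinge at [c] is flat up to [c] and has slope one from there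
    to the target: its outgoing slopes are [+1] at [c] and [-1] at the target. *)
Definition hinge_div h : divisor G :=
  \sum_e \sum_(u <- h e) (<< u.1 *g epoint e u.2 >> - << u.1 *g inl (tgt e) >>).

(** The order of vanishing is a sum of slopes along the edges at the point, and
    each slope is additive over hinges, although a single hinge need not extend
    to a continuous function on the graph. *)
Lemma ord_at_hinges f (c : edge G -> R) h :
  (forall e, {in h e, forall u, 0 <= u.2 <= len e}) ->
  (forall e s, 0 <= s <= len e -> f (epoint e s) = c e + hinge_sum (h e) s) ->
  forall p, ord_at f p = coeff p (hinge_div h).
Proof.
move=> hP fP p; rewrite /hinge_div raddf_sum /=.
under eq_bigr do rewrite raddf_sum /=.
case: p => [v|[[e s] sP]] /=.
    rewrite [X in X + _]big_mkcond [X in _ + X]big_mkcond -big_split /=.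
    apply: eq_bigr => e _.
    have -> : (if src e == v then slope (fun x => f (epoint e x)) else 0) =
        \sum_(u <- h e) u.1 * ((src e == v) && (u.2 <= 0))%:R.
      case: eqP => _; last by rewrite big1 // => u _; rewrite mulr0.
      rewrite -(slope_hinge_sum_right (l := len e) _ (fP e)) ?lexx ?len_gt0//.
      by congr slope; apply/funext => x; rewrite add0r.
    have -> : (if tgt e == v then slope (fun x => f (epoint e (len e - x))) else 0) =
        - \sum_(u <- h e) u.1 * ((tgt e == v) && (u.2 < len e))%:R.
      case: eqP => _; last by rewrite big1 ?oppr0// => u _; rewrite mulr0.
      by rewrite (slope_hinge_sum_left (l := len e) _ (fP e)) ?lexx ?len_gt0.
    rewrite -sumrB; apply: eq_big_seq => u /(hP e) uP.
    rewrite coeffB !coeffU epoint_eq_inl// -!mulrBr; congr (_ * _).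
    case/andP: uP; rewrite le_eqVlt => /predU1P[<- _|u0].

      rewrite lexx eqxx (lt_eqF (len_gt0 e)) len_gt0 !andbT orbF.
      by rewrite [inl _ == _]/eq_op.
    rewrite le_eqVlt => /predU1P[uE|ul].
      by rewrite uE ltxx eqxx leNgt len_gt0 (gt_eqF (len_gt0 e)) !andbF/=
           [inl _ == _]/eq_op /= !subrr.
    by rewrite (gt_eqF u0) (lt_eqF ul) ul leNgt u0 andbF andbT.
have se : 0 <= s <= len e by case/andP: sP => /ltW -> /ltW.
rewrite (bigD1 e) //= [X in _ = _ + X]big1 ?addr0; last first.
  move=> e' e'e; apply: big1_seq => u /(hP e') uP.
  by rewrite coeffB !coeffU epoint_eq_inr//= [e == e']eq_sym (negbTE e'e) !mulr0.
case/andP: (sP) => /= s0 sl.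
rewrite (slope_hinge_sum_right (l := len e) _ (fP e)) ?sl ?ltW//.
rewrite (slope_hinge_sum_left (l := len e) _ (fP e)) ?s0 ?ltW//.
rewrite -sumrB; apply: eq_big_seq => u /(hP e) uP /=.
rewrite coeffB !coeffU epoint_eq_inr//= eqxx /= mulr0 subr0 -mulrBr.
by congr (_ * _); rewrite [u.2 < s]lt_neqAle eq_sym; case: eqVneq => [->|_] /=;
  rewrite ?lexx ?subr0 ?subrr.
Qed.

Definition principal D := exists2 f, rational_function f & forall p, coeff p D = ord_at f p.

Lemma principalE D : principal D <-> exists f h,
  [/\ forall e, {in h e, forall u, 0 <= u.2 <= len e},
      forall e s, 0 <= s <= len e ->
        f (epoint e s) = f (inl (src e)) + hinge_sum (h e) s &
      D = hinge_div h].
Proof.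
split=> [[f f_rat fD]|[f [h [hP fP ->]]]]; last first.
  exists f => [e|p]; last by rewrite (ord_at_hinges hP fP).
  exact: hinge_sum_piecewise_linear (len_gt0 e) (fP e).
have /choice[h hP] e : exists k, {in k, forall u, 0 <= u.2 <= len e} /\
    forall s, 0 <= s <= len e -> f (epoint e s) = f (inl (src e)) + hinge_sum k s.
  by have [k] := piecewise_linear_hinge_sum (f_rat e); exists k; rewrite -epoint0.
exists f, h; split=> [e|e|]; [exact: (hP e).1|exact: (hP e).2|].
apply/eqP/freeg_eqP => p; rewrite fD.
by apply: ord_at_hinges => [e|e]; [exact: (hP e).1|exact: (hP e).2].
Qed.

Lemma deg_hinge_div h : deg (hinge_div h) = 0.
Proof.
rewrite /hinge_div raddf_sum big1 // => e _; rewrite raddf_sum big1 // => u _.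
by rewrite /= degB !degU subrr.
Qed.
End GraphDivisors.

(** * Weighted sums over a divisor *)

Section Weight.
Context {T : choiceType} {V : zmodType} (x : T -> V).
Implicit Types D : {freeg T / int}.

Definition weight D : V := \sum_(p <- dom D) x p *~ coeff p D.

Lemma weight_dom D (s : seq T) : uniq s -> {subset dom D <= s} ->
  weight D = \sum_(p <- s) x p *~ coeff p D.
Proof.
move=> s_uniq Ds; have : perm_eq (dom D) [seq p <- s | p \in dom D].
  apply: uniq_perm; rewrite ?uniq_dom ?filter_uniq// => p.
  by rewrite mem_filter; case: (boolP (p \in dom D)) => //= /Ds.
move=> Dperm; rewrite /weight (perm_big _ Dperm) big_filter big_mkcond; apply: eq_bigr => p _.
by case: ifPn => // /coeff_outdom ->.
Qed.

Lemma weight_is_zmod_morphism : zmod_morphism weight.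
Proof.
move=> D E; pose s := undup (dom D ++ dom E).
have sub F : {subset dom F <= dom D ++ dom E} -> {subset dom F <= s}.
  by move=> Fs p /Fs; rewrite mem_undup.
have s_uniq : uniq s by exact: undup_uniq.
rewrite !(weight_dom s_uniq); last first.
- by apply: sub; exact: domB.
- by apply: sub => p pD; rewrite mem_cat pD.
- by apply: sub => p pE; rewrite mem_cat pE orbT.
by rewrite -sumrB; apply: eq_bigr => p _; rewrite coeffB mulrzBr.
Qed.

HB.instance Definition _ :=
  GRing.isZmodMorphism.Build {freeg T / int} V weight weight_is_zmod_morphism.

Lemma weightB D E : weight (D - E) = weight D - weight E.
Proof. exact: raddfB. Qed.

Lemma weightD D E : weight (D + E) = weight D + weight E.
Proof. exact: raddfD. Qed.

Lemma weight_sum I (s : seq I) (F : I -> {freeg T / int}) :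
  weight (\sum_(j <- s) F j) = \sum_(j <- s) weight (F j).
Proof. exact: raddf_sum. Qed.

Lemma weightU k p : weight << k *g p >> = x p *~ k.
Proof.
have [->|k0] := eqVneq k 0; first by rewrite freegU0 raddf0 mulr0z.
by rewrite /weight domU// big_seq1 coeffU eqxx mulr1.
Qed.
End Weight.

(** * Retracting a chain onto its edges *)

Section ChainRetraction.
Context {R : realType} {n : nat} (C : chain R n).
Notation G := (chain_graph C).

(** The retraction of a chain onto an edge sends what lies to the left of the edge
    to its left end, and what lies to the right to its right end. A cycle is cut
    open at [w_i]: the value on the edge from [v_i] to [w_i] is [0] at both of its
    ends, so that the values on the two edges of a cycle add up to the clockwise
    coordinate in [0, l_i[ starting at [w_i]. *)
Definition vertex_retract (e : edge G) (v : vertex G) : R :=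
  match e with
  | inl (i, true) => 0
  | inl (i, false) =>
      if (match v with inl k => (k < i)%N | inr k => (val k <= i)%N end)
      then cycle_len C i - arc_len C i else 0
  | inr j =>
      if (match v with inl k => k : nat | inr k => val k end <= val j)%N
      then 0 else bridge_len C (val j)
  end.

Definition retract (e : edge G) (p : gpoint G) : R :=
  match p with
  | inl v => vertex_retract e v
  | inr x => if e == (val x).1 then (val x).2 else vertex_retract e (src (val x).1)
  end.

Lemma bridge_len_glued (j : 'I_n) :
  glued C (lift ord0 j) = (bridge_len C j == 0).
Proof. by rewrite /glued liftK. Qed.

Lemma gluedP (i : 'I_n.+1) : glued C i ->
  exists2 j : 'I_n, i = lift ord0 j & bridge_len C j = 0.
Proof. by rewrite /glued; case: unliftP => // j -> /eqP; exists j. Qed.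

Lemma bump_ord (j : 'I_n) : bump n j = j.
Proof. exact: lift_max. Qed.

Lemma vertex_retract_v (e : edge G) (i : 'I_n.+1) :
  vertex_retract e (v_vertex C i) =
  match e with
  | inl (k, true) => 0
  | inl (k, false) => if (i <= k)%N then cycle_len C k - arc_len C k else 0
  | inr j => if (i <= val j)%N then 0 else bridge_len C (val j)
  end.
Proof.
rewrite /v_vertex; case: insubP => [x _ <-|/negPn/gluedP[j -> bj]].
  by case: e => [[k []]|j].
have jE : (inord (lift ord0 j).-1 : 'I_n.+1) = j :> nat.
  by rewrite inordK //=; exact: leq_trans (ltn_ord j) _.
case: e => [[k []]|k] //=; rewrite jE /= /bump //= add1n.
rewrite [in LHS]leq_eqVlt; case: eqVneq => //= jk.
case: k jk => k k0 /= /val_inj jk; by rewrite -jk bj ltxx in k0.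
Qed.

Lemma vertex_retract_src (e : edge G) : vertex_retract e (src e) = 0.
Proof.
by case: e => [[i []]|j] //=; rewrite ?ltnn // bump_ord leqnn.
Qed.

Lemma retract_bounds (e : edge G) p : 0 <= retract e p <= len e.
Proof.
have vP v : 0 <= vertex_retract e v <= len e.
  have := ltW (len_gt0 e); case: e => [[i []]|j] /= l0;
    do ?[case: ifP => _]; by rewrite ?lexx ?l0.
case: p => [v|[[e' s] /= /andP[s0 sl]]] //=.
by case: eqP => [->|//]; rewrite !ltW.
Qed.

Lemma retract_v (e : edge G) (i : 'I_n.+1) :
  retract e (inl (v_vertex C i)) =
  match e with
  | inl (k, true) => 0
  | inl (k, false) => if (i <= k)%N then cycle_len C k - arc_len C k else 0
  | inr j => if (i <= val j)%N then 0 else bridge_len C (val j)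
  end.
Proof. exact: vertex_retract_v. Qed.

(** A sum of functions of the individual retractions changes along an edge through
    the term of that edge only. The hypothesis that the total change around each
    cycle is zero compensates for the jump of the retraction onto the second edge at [w_i]. It is
    used both for real-valued functions, to construct rational functions, and for
    divisor-valued ones, to decompose a point. *)
Lemma retract_potential (V : zmodType) (F : edge G -> R -> V) :
  (forall e, F e 0 = 0) ->
  (forall i, F (inl (i, false)) (cycle_len C i - arc_len C i) +
             F (inl (i, true)) (arc_len C i) = 0) ->
  let U p := \sum_e F e (retract e p) in
  forall (e : edge G) s, 0 <= s <= len e ->
    U (epoint e s) = U (inl (src e)) + F e s.
Proof.
move=> F0 F_cycle U.
have U_w i : U (inl (v_vertex C i)) = U (inl (w_vertex C i)) +
    F (inl (i, false)) (cycle_len C i - arc_len C i).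
  rewrite /U (bigD1 (inl (i, false))) // [in RHS](bigD1 (inl (i, false))) //.
  rewrite retract_v /= leqnn ltnn F0 add0r addrC; congr (_ + _).
  apply: eq_bigr => -[[k []]|j] // ki; rewrite vertex_retract_v //=.
  rewrite leq_eqVlt; case: eqVneq => //= ik.
  by rewrite (val_inj ik : i = k) eqxx in ki.
have U_tgt e : U (inl (tgt e)) = U (inl (src e)) + F e (len e).
  case: e => [[i []]|j] //=.
    by rewrite U_w -addrA F_cycle addr0.
  rewrite /U (bigD1 (inr j)) // [in RHS](bigD1 (inr j)) //.
  rewrite retract_v /= bump_ord /bump add1n ltnn leqnn F0 add0r addrC.
  congr (_ + _); apply: eq_bigr => -[[k []]|k] // kj; rewrite vertex_retract_v //=.
    by rewrite bump_ord.
  rewrite bump_ord /bump add1n.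
  rewrite [(val j <= _)%N]leq_eqVlt; case: eqVneq => //= jk.
  by rewrite (val_inj (val_inj jk) : j = k) eqxx in kj.
move=> e s /andP[]; rewrite le_eqVlt => /predU1P[<- _|s0].
  by rewrite epoint0 F0 addr0.
rewrite le_eqVlt => /predU1P[->|sl]; first by rewrite epoint_len.
have sP : 0 < s < len e by rewrite s0.
rewrite (epoint_inner sP) /U (bigD1 e) //= [in RHS](bigD1 e) //= eqxx.
rewrite vertex_retract_src F0 add0r addrC; congr (_ + _).
by apply: eq_bigr => e' /negbTE ->.
Qed.

(** Connectedness of the chain, in the form in which it is used. Across a bridge of
    length zero there is nothing to prove, since its ends are the same vertex. *)
Lemma chain_connected (T : Type) (U : gpoint G -> T) :
  (forall (e : edge G) s, 0 <= s <= len e -> U (epoint e s) = U (inl (src e))) ->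
  forall p, U p = U (marked_point C).
Proof.
move=> U_edge.
have U_tgt e : U (inl (tgt e)) = U (inl (src e)).
  by rewrite -epoint_len U_edge// lexx ltW// len_gt0.
have U_v i : U (inl (v_vertex C i)) = U (inl (w_vertex C i)).
  exact: (U_tgt (inl (i, false))).
have U_w : forall i, U (inl (w_vertex C i)) = U (inl (w_vertex C ord0)).
  case=> k; elim: k => [|k IH] kn; first by congr (U (inl _)); congr inl; apply: val_inj.
  rewrite -(IH (ltnW kn)) -U_v.
  have jn : (k < n)%N by [].
  have -> : Ordinal kn = lift ord0 (Ordinal jn) by apply: val_inj.
  have lE : lift ord_max (Ordinal jn) = Ordinal (ltnW kn).
    by apply: val_inj; exact: lift_max.
  have [b0|b0] := eqVneq (bridge_len C (Ordinal jn)) 0; last first.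
    have b_gt0 : 0 < bridge_len C (Ordinal jn) by rewrite lt_def b0 bridge_len_ge0.
    by have := U_tgt (inr (exist _ (Ordinal jn) b_gt0)); rewrite /= lE.
  rewrite /v_vertex; case: insubP => [x|_]; first by rewrite bridge_len_glued b0 eqxx.
  congr (U (inl (inl _))); apply: val_inj => /=.
  by rewrite inordK // ltnW.
have U_vtx v : U (inl v) = U (inl (w_vertex C ord0)).
  case: v => [k|k]; first exact: U_w.
  rewrite -(U_w (val k)) -U_v /v_vertex; congr (U (inl _)).
  by case: insubP => [x _ /val_inj ->|] //; rewrite (valP k).
move=> p; rewrite [RHS]U_vtx; case: p => [v|[[e s] sP]]; first exact: U_vtx.
by rewrite -epoint_inner U_edge ?U_vtx//; case/andP: (sP) => /ltW -> /ltW ->.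
Qed.

End ChainRetraction.

(** * Linear equivalence on a chain of cycles *)

Section AbelJacobi.
Context {R : realType} {n : nat} (C : chain R n).
Notation G := (chain_graph C).
Notation mp := (marked_point C).

Definition cycle_coord (i : 'I_n.+1) (p : gpoint G) : R :=
  retract (inl (i, false)) p + retract (inl (i, true)) p.

Lemma sum_edges_cycle (V : zmodType) (F : edge G -> V) (i : 'I_n.+1) :
  (forall e, e != inl (i, false) -> e != inl (i, true) -> F e = 0) ->
  \sum_e F e = F (inl (i, false)) + F (inl (i, true)).
Proof.
move=> F0; rewrite (bigD1 (inl (i, false))) //= (bigD1 (inl (i, true))) /=.
  by rewrite big1 ?addr0 // => e /andP[]; exact: F0.
by apply/eqP => -[].
Qed.

Lemma sum_chain_edges (V : zmodType) (F : edge G -> V) :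
  \sum_e F e = \sum_i (F (inl (i, false)) + F (inl (i, true))) + \sum_j F (inr j).
Proof.
rewrite big_sumType /=; congr (_ + _).
rewrite (eq_bigr (fun p => F (inl (p.1, p.2)))) => [|[]]//.
rewrite -(pair_bigA _ (fun i b => F (inl (i, b)))) /=; apply: eq_bigr => i _.
by rewrite big_bool addrC.
Qed.

(** How [cycle_coord i] grows along an edge: with unit speed on the [i]-th cycle,
    except that it drops by the full length on coming back to [w_i]. *)
Definition coord_shift (i : 'I_n.+1) (e : edge G) (s : R) : R :=
  if e == inl (i, false) then s
  else if e == inl (i, true) then
    if s < arc_len C i then s else s - cycle_len C i
  else 0.

Lemma cycle_coord_epoint (i : 'I_n.+1) (e : edge G) s : 0 <= s <= len e ->
  cycle_coord i (epoint e s) = cycle_coord i (inl (src e)) + coord_shift i e s.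
Proof.
have tf k : (inl (k, true) == inl (k, false) :> edge G) = false by apply/eqP => -[].
have UE p : \sum_e coord_shift i e (retract e p) = cycle_coord i p.
  rewrite (sum_edges_cycle (i := i)) /coord_shift.
    rewrite eqxx tf eqxx; congr (_ + _); case: ifP => // /negbT; rewrite -leNgt.
    case: p => [v|[[e' r] /= rP]] /=; first by rewrite leNgt arc_len_gt0.
    case: eqP => [eE|_]; last by rewrite leNgt arc_len_gt0.
    by move: rP; rewrite -eE /= => /andP[_ /lt_geF ->].
  by move=> e' /negbTE -> /negbTE ->.
move=> sP; rewrite -!UE (retract_potential (F := coord_shift i)) //.
  by move=> e'; rewrite /coord_shift arc_len_gt0; do ![case: ifP => // _].
move=> k; rewrite /coord_shift; case: (eqVneq k i) => [->|ki].
  by rewrite eqxx tf eqxx ltxx; ring.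
have ki' b c : (inl (k, b) == inl (i, c) :> edge G) = false.
  by apply/eqP => -[/eqP]; rewrite (negbTE ki).
by rewrite !ki' addr0.
Qed.

Lemma freegU_intz (c : int) (p : gpoint G) : << c *g p >> = << p >> *~ c :> divisor G.
Proof. by rewrite freegU_mulz intz. Qed.

(** The hinges at the retractions of one point telescope along the chain. Both
    sides are potentials in [p] with the same variation along every edge, and they
    agree at the marked point. *)
Lemma hinge_div_point (p : gpoint G) :
  \sum_e (<< epoint e (retract e p) >> - << inl (tgt e) >>) =
  << p >> - << mp >> :> divisor G.
Proof.
pose F (e : edge G) s : divisor G := << epoint e s >> - << inl (src e) >>.
pose U q := \sum_e F e (retract e q).
have UP := @retract_potential _ _ C _ F; rewrite -/U /= in UP.
have /(@chain_connected _ _ C _ (fun q => U q - << q >>)) UE : forall (e : edge G) s, 0 <= s <= len e ->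
    U (epoint e s) - << epoint e s >> = U (inl (src e)) - << inl (src e) >>.
  move=> e s sP; rewrite UP //.
  - by rewrite /F -addrA [X in _ + X]addrAC subrr add0r.
  - by move=> e'; rewrite /F epoint0 subrr.
  - move=> i; rewrite /F -[cycle_len C i - _]/(len (inl (i, false) : edge G)).
    rewrite -[arc_len C i]/(len (inl (i, true) : edge G)) !epoint_len.
    by rewrite /= addrA subrK subrr.
pose W q : divisor G :=
  \sum_e (<< epoint e (retract e q) >> - << inl (tgt e) >>).
have UW q : U q = W q + \sum_e (<< inl (tgt e) >> - << inl (src e) >>).
  by rewrite -big_split; apply: eq_bigr => e _ /=; rewrite /F addrA subrK.
have W0 : W mp = 0.
  rewrite /W sum_chain_edges !big1 ?addr0 // => [[j bj]|i] _.
    rewrite [retract _ _](_ : _ = len (inr (exist _ j bj) : edge G)) ?epoint_len ?subrr//.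
    by rewrite /= leqNgt ltn_ord.
  rewrite [retract _ _](_ : _ = 0) ?epoint0; last by rewrite /= ltnNge -ltnS ltn_ord.
  by rewrite /= addrA subrK subrr.
have := UE p; rewrite !UW W0 add0r -/(W p) -addrA => WE.
by apply: (addIr (\sum_e (<< inl (tgt e) >> - << inl (src e) >>) - << p >>));
  rewrite WE [RHS]addrC addrA subrK.
Qed.

Definition cycle_weight (i : 'I_n.+1) (D : divisor G) : R :=
  weight (cycle_coord i) D.

Lemma cycle_weightE i D : cycle_weight i D =
  weight (retract (inl (i, false))) D + weight (retract (inl (i, true))) D.
Proof.
by rewrite /cycle_weight /weight -big_split /=; apply: eq_bigr => p _; rewrite mulrzDl.
Qed.

Lemma cycle_weightD i D E : cycle_weight i (D + E) = cycle_weight i D + cycle_weight i E.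
Proof. exact: weightD. Qed.

Lemma cycle_weightB i D E : cycle_weight i (D - E) = cycle_weight i D - cycle_weight i E.
Proof. exact: weightB. Qed.

Lemma weight_hinge_div (x : gpoint G -> R) h : weight x (hinge_div h) =
  \sum_e \sum_(u <- h e) u.1%:~R * (x (epoint e u.2) - x (inl (tgt e))).
Proof.
rewrite weight_sum; apply: eq_bigr => e _; rewrite weight_sum.
by apply: eq_bigr => u _; rewrite weightB !weightU mulrBr !mulrzl.
Qed.

(** On the edges of the [i]-th cycle the weight of the divisor of [f] is the
    opposite of the variation of [f], and the two variations cancel around the
    cycle. What remains are the jumps of the coordinate at [w_i], which are
    integer multiples of the length. *)
Lemma principal_chain_weight D i : principal D ->
  exists k : int, cycle_weight i D = k%:~R * cycle_len C i.
Proof.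
case/principalE=> f [h [hP fP ->]].
have fE (e : edge G) : hinge_sum (h e) (len e) = f (inl (tgt e)) - f (inl (src e)).
  by rewrite -epoint_len fP ?lexx ?ltW ?len_gt0// addrAC subrr add0r.
have term (e : edge G) u : u \in h e ->
    cycle_coord i (epoint e u.2) - cycle_coord i (inl (tgt e)) =
    coord_shift i e u.2 - coord_shift i e (len e).
  move=> /(hP e) uP; rewrite -epoint_len !cycle_coord_epoint//.
    by rewrite opprD addrACA subrr add0r.
  by rewrite lexx ltW ?len_gt0.
(* A hinge at the very end of the edge has no jump to account for. *)
exists (\sum_(u <- h (inl (i, true))) u.1 * (u.2 < arc_len C i)%R%:R).
rewrite /cycle_weight weight_hinge_div (sum_edges_cycle (i := i)); last first.
  move=> e /negbTE ef /negbTE et; rewrite big1_seq // => u /andP[_ /term ->].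
  by rewrite /coord_shift ef et subrr mulr0.
have -> : \sum_(u <- h (inl (i, false))) u.1%:~R *
    (cycle_coord i (epoint (inl (i, false) : edge G) u.2) -
     cycle_coord i (inl (tgt (inl (i, false) : edge G)))) =
    - hinge_sum (h (inl (i, false))) (len (inl (i, false) : edge G)).
  rewrite /hinge_sum -sumrN; apply: eq_big_seq => u uh; rewrite term//.
  rewrite max_r ?subr_ge0; last by case/andP: (hP _ _ uh).
  by rewrite /coord_shift eqxx; ring.
have -> : \sum_(u <- h (inl (i, true))) u.1%:~R *
    (cycle_coord i (epoint (inl (i, true) : edge G) u.2) -
     cycle_coord i (inl (tgt (inl (i, true) : edge G)))) =
    - hinge_sum (h (inl (i, true))) (len (inl (i, true) : edge G)) +
    \sum_(u <- h (inl (i, true))) u.1%:~R * (u.2 < arc_len C i)%R%:R * cycle_len C i.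
  rewrite /hinge_sum -sumrN -big_split; apply: eq_big_seq => u uh /=; rewrite term//.
  have /andP[_ /= ua] := hP _ _ uh; rewrite max_r ?subr_ge0//.
  have tf : (inl (i, true) == inl (i, false) :> edge G) = false by apply/eqP => -[].
  rewrite /coord_shift tf eqxx ltxx /=; move: ua; rewrite le_eqVlt => /predU1P[->|->].
    by rewrite ltxx /=; ring.
  by rewrite mulr1n; ring.
rewrite !fE /= rmorph_sum mulr_suml /=.
under [RHS]eq_bigr do rewrite rmorphM /= rmorph_nat.
by set S := \sum_(u <- _) _; ring.
Qed.

(** The function is assembled from hinges at the retractions of the points of [D].
    By [hinge_div_point] they produce the divisor [D] minus its degree times the
    marked point. On each cycle the sum of hinges comes back to its initial value
    after the linear function of slope [k i] is added, and this slope leaves the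
    divisor unchanged. *)
Lemma chain_principal D : deg D = 0 ->
  (forall i, exists k : int, cycle_weight i D = k%:~R * cycle_len C i) ->
  principal D.
Proof.
move=> D0 /choice[k kP]; apply/principalE.
(* The hinge at 0 is the linear function that closes up each cycle. *)
pose k_edge (e : edge G) := match e with inl (i, _) => k i | inr _ => 0 end.
pose h (e : edge G) := (k_edge e, 0) :: [seq (coeff p D, retract e p) | p <- dom D].
pose f p := \sum_e hinge_sum (h e) (retract e p).
have hP e : {in h e, forall u, 0 <= u.2 <= len e}.
  move=> u; rewrite inE => /predU1P[->|/mapP[p _ ->]]; last exact: retract_bounds.
  by rewrite lexx ltW ?len_gt0.
have sumD : \sum_(p <- dom D) coeff p D = 0.
  rewrite -[RHS]D0 -[in RHS](freeg_sumE D) raddf_sum /=.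
  by apply: eq_bigr => p _; rewrite degU.
have hE (e : edge G) : hinge_sum (h e) (len e) =
    (k_edge e)%:~R * len e - weight (retract e) D.
  rewrite hinge_sum_cons subr0 max_r ?ltW ?len_gt0//; congr (_ + _).
  rewrite /hinge_sum big_map /weight.
  transitivity (\sum_(p <- dom D) ((coeff p D)%:~R * len e - retract e p *~ coeff p D)).
    apply: eq_bigr => p _ /=; rewrite max_r ?subr_ge0; last by case/andP: (retract_bounds e p).
    by rewrite mulrBr !mulrzl.
  by rewrite sumrB -mulr_suml -rmorph_sum sumD mul0r sub0r.
exists f, h; split=> //.
  apply: retract_potential => [e|i]; first by apply: hinge_sum0 => u /hP/andP[].
  rewrite -[cycle_len C i - _]/(len (inl (i, false) : edge G)).
  rewrite -[arc_len C i]/(len (inl (i, true) : edge G)) !hE /=.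
  by have := kP i; rewrite cycle_weightE => wE; rewrite addrACA -opprD wE; ring.
have -> : hinge_div h = \sum_e (<< k_edge e *g epoint e 0 >> - << k_edge e *g inl (tgt e) >>)
   + \sum_(p <- dom D) \sum_e (<< coeff p D *g epoint e (retract e p) >> -
                               << coeff p D *g inl (tgt e) >>).
  rewrite exchange_big -big_split /=; apply: eq_bigr => e _.
  by rewrite big_cons big_map.
rewrite [X in X + _](_ : _ = 0) ?add0r; last first.
  rewrite sum_chain_edges !big1 ?addr0 // => [j|i] _.
    by rewrite /= !freegU0 subrr.
  by rewrite !epoint0 /= addrA subrK subrr.
transitivity (\sum_(p <- dom D) (<< p >> - << mp >> : divisor G) *~ coeff p D).
  rewrite -[LHS](freeg_sumE D).
  under [RHS]eq_bigr do rewrite mulrzBl.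
  rewrite sumrB -mulrz_sumr sumD mulr0z subr0.
  by apply: eq_bigr => p _; rewrite freegU_intz.
apply: eq_bigr => p _; rewrite -hinge_div_point mulrz_suml; apply: eq_bigr => e _.
by rewrite mulrzBl -!freegU_intz.
Qed.
End AbelJacobi.

(** * The chip game *)

Section CongrMod.
Context {R : realType}.
Implicit Types l x y z : R.

Definition congr_mod l x y := exists k : int, x - y = k%:~R * l.

Lemma congr_mod_refl l x : congr_mod l x x.
Proof. by exists 0; rewrite subrr mul0r. Qed.

Lemma congr_mod_sym l x y : congr_mod l x y -> congr_mod l y x.
Proof. by case=> k kE; exists (- k); rewrite mulrNz mulNr -kE opprB. Qed.

Lemma congr_mod_trans l y x z :
  congr_mod l x y -> congr_mod l y z -> congr_mod l x z.
Proof.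
case=> k kE [m mE]; exists (k + m).
by rewrite rmorphD mulrDl -kE -mE addrA subrK.
Qed.

Lemma congr_modD l x y x' y' :
  congr_mod l x y -> congr_mod l x' y' -> congr_mod l (x + x') (y + y').
Proof.
case=> k kE [m mE]; exists (k + m).
by rewrite rmorphD mulrDl -kE -mE opprD addrACA.
Qed.

Lemma congr_modN l x y : congr_mod l x y -> congr_mod l (- x) (- y).
Proof. by case=> k kE; exists (- k); rewrite mulrNz mulNr -kE opprB opprK addrC. Qed.

Lemma congr_modB l x y x' y' :
  congr_mod l x y -> congr_mod l x' y' -> congr_mod l (x - x') (y - y').
Proof. by move=> xy /congr_modN; exact: congr_modD. Qed.

Lemma congr_mod_sum l (I : Type) (s : seq I) (f g : I -> R) :
  (forall i, congr_mod l (f i) (g i)) ->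
  congr_mod l (\sum_(i <- s) f i) (\sum_(i <- s) g i).
Proof.
move=> fg; elim/big_rec2: _ => [|i x y _]; first exact: congr_mod_refl.
exact: congr_modD.
Qed.
End CongrMod.

Section ChipGame.
Context {R : realType} (l a : nat -> R).
Hypothesis l_gt0 : forall i, 0 < l i.
Implicit Types (u : nat * R) (s : seq (nat * R)) (q : nat -> R) (i j : nat).

(** A chip [(k, c)] stands for the point of coordinate [c] on the [k]-th cycle. It
    retracts to [w_i] on the cycles to its left and to [v_i], of coordinate [- a i]
    modulo the length, on those to its right. *)
Definition chip_coord u i : R :=
  if (i < u.1)%N then 0 else if i == u.1 then u.2 else - a i.

Definition chips_coord s i : R := \sum_(u <- s) chip_coord u i.

Definition chips_left s i : nat := count (fun u => (u.1 < i)%N) s.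

Lemma chips_coord_cons u s i :
  chips_coord (u :: s) i = chip_coord u i + chips_coord s i.
Proof. exact: big_cons. Qed.

Lemma chips_coord_avoid s i : {in s, forall u, u.1 != i} ->
  chips_coord s i = - a i * (chips_left s i)%:R.
Proof.
elim: s => [|u s IH] si; first by rewrite /chips_coord big_nil mulr0.
rewrite chips_coord_cons IH; last by move=> v vs; rewrite si// inE vs orbT.
have := si u (mem_head _ _); rewrite /chip_coord /= eq_sym => /negbTE ->.
rewrite natrD mulrDr; congr (_ + _).
case: (ltngtP u.1 i) => iu; rewrite ?mulr1 ?mulr0 //.
by move: (si u (mem_head _ _)); rewrite iu eqxx.
Qed.

Lemma chips_leftS s i :
  chips_left s i.+1 = (chips_left s i + count (fun u => u.1 == i) s)%N.
Proof.
elim: s => //= u s ->; rewrite ltnS [(u.1 <= i)%N]leq_eqVlt.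
by case: (ltngtP u.1 i) => _ /=; lia.
Qed.

Lemma chips_left_all s i : all (fun u => u.1 < i)%N s -> chips_left s i = size s.
Proof. by rewrite all_count => /eqP. Qed.

Lemma chip_coord_right u i : (i < u.1)%N -> chip_coord u i = 0.
Proof. by rewrite /chip_coord => ->. Qed.

(** With [T] chips to its left and none on it, the [i]-th cycle has weight
    [- a i * T]. *)
Definition special q i (T : int) : bool := `[< congr_mod (l i) (q i) (- a i * T%:~R) >].

(** The number of chips on the first [i] cycles when a chip is placed only where
    the weight [q] cannot be obtained without one. *)
Fixpoint greedy q i : nat :=
  if i is j.+1 then (greedy q j + ~~ special q j (greedy q j))%N else 0%N.

Lemma congr_greedy q q' i :
  (forall j, (j < i)%N -> congr_mod (l j) (q j) (q' j)) ->
  greedy q i = greedy q' i.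
Proof.
elim: i => //= i IH qq'; rewrite IH => [|j ji]; last exact/qq'/ltnW.
congr (_ + ~~ _)%N; apply/asboolP/asboolP; apply: congr_mod_trans.
  by apply: congr_mod_sym; exact: qq'.
exact: qq'.
Qed.

(** Placing chips lazily is optimal: against a player who is ahead, the lazy player
    adds at most one chip and at worst draws level; when both have placed the same
    number, the lazy player adds a chip only if the other one has to. *)
Lemma greedy_le_chips q s i :
  (forall j, (j < i)%N -> congr_mod (l j) (q j) (chips_coord s j)) ->
  (greedy q i <= chips_left s i)%N.
Proof.
elim: i => //= i IH qs; have {IH} := IH (fun j ji => qs j (ltnW ji)).
rewrite chips_leftS; case: (boolP (has (fun u => u.1 == i) s)).
  by rewrite has_count; case: (special _ _ _); lia.
move=> s_i; rewrite leq_eqVlt => /predU1P[->|]; last by lia.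
suff -> : special q i (chips_left s i) by lia.
apply/asboolP; rewrite -chips_coord_avoid; first exact: qs.
by move=> u us; apply: contra s_i => ui; apply/hasP; exists u.
Qed.

(** A chip on the current cycle has a free coordinate, so it can correct the weight
    there, and it does not change the weights of the cycles to its left. *)
Lemma greedy_chips q i : exists s, [/\ size s = greedy q i,
  all (fun u => u.1 < i)%N s &
  forall j, (j < i)%N -> congr_mod (l j) (q j) (chips_coord s j)].
Proof.
elim: i => [|i [s [s_size s_lt sq]]]; first by exists [::].
have s_lt' : all (fun u => u.1 < i.+1)%N s.
  by apply: sub_all s_lt => u ui; rewrite ltnS ltnW.
have sE : chips_coord s i = - a i * (greedy q i)%:R.
  rewrite chips_coord_avoid ?chips_left_all ?s_size// => u /(allP s_lt).
  by rewrite neq_ltn => ->.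
rewrite /=; case: (boolP (special _ _ _)) => [/asboolP spi|_].
  exists s; split=> // [|j]; first by rewrite addn0.
  by rewrite ltnS leq_eqVlt => /predU1P[->|/sq//]; rewrite sE.
exists ((i, q i - chips_coord s i) :: s); split=> [||j].
- by rewrite /= s_size addn1.
- by rewrite /= ltnSn.
rewrite chips_coord_cons ltnS leq_eqVlt => /predU1P[->|ji].
  by rewrite /chip_coord ltnn eqxx subrK; exact: congr_mod_refl.
by rewrite chip_coord_right// add0r; exact: sq.
Qed.

Lemma effective_greedyP q (g d : nat) : (0 < g)%N ->
  (exists s, [/\ size s = d, all (fun u => u.1 < g)%N s &
     forall j, (j < g)%N -> congr_mod (l j) (q j) (chips_coord s j)]) <->
  (greedy q g <= d)%N.
Proof.
move=> g0; split=> [[s [<- s_lt sq]]|qd].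
  by rewrite -(chips_left_all s_lt) greedy_le_chips.
have [s [s_size s_lt sq]] := greedy_chips q g.
(* A chip at coordinate 0 of the last cycle has weight zero everywhere. *)
exists (s ++ nseq (d - greedy q g) (g.-1, 0)); split=> [||j jg].
- by rewrite size_cat size_nseq s_size subnKC.
- by rewrite all_cat s_lt all_nseq /= prednK// leqnn orbT.
rewrite /chips_coord big_cat /= big_nseq.
rewrite [X in _ + X](_ : _ = 0) ?addr0; first exact: sq.
rewrite /chip_coord /=.
have -> : (if (j < g.-1)%N then 0 else if j == g.-1 then 0 else - a j) = 0 :> R.
  by case: ltngtP => //; lia.
by elim: (d - _)%N => //= k ->; rewrite addr0.
Qed.

(** The partition grown by the first [i] cycles, extended by the quadrants
    [x <= 0] and [y <= 0]. At step [j] all addable boxes on the diagonals [x - y]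
    selected by the weight [q j] are added: with [d = j - x + y] this selection is
    [special q j d]. *)
Fixpoint rank_boxes q i (x y : int) : bool :=
  if i is j.+1 then
    rank_boxes q j x y ||
    [&& rank_boxes q j (x - 1) y, rank_boxes q j x (y - 1) &
        special q j (j%:Z - x + y)]
  else (x <= 0) || (y <= 0).

Lemma rank_boxes_le0 q i x y : (x <= 0) || (y <= 0) -> rank_boxes q i x y.
Proof. by move=> xy; elim: i => //= i ->. Qed.



Lemma rank_boxes_homo q i j x y : (i <= j)%N -> rank_boxes q i x y -> rank_boxes q j x y.
Proof. by move=> /subnK <- xy; elim: (j - i)%N => //= k ->. Qed.

Lemma rank_boxes_pred q i x y : rank_boxes q i x y -> rank_boxes q i (x - 1) y && rank_boxes q i x (y - 1).
Proof.
elim: i => [|i IH] /=; first by lia.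
by case/orP => [/IH/andP[-> ->]//|/and3P[-> -> _]].
Qed.

Lemma rank_boxes_le q i x y x' y' : x' <= x -> y' <= y -> rank_boxes q i x y -> rank_boxes q i x' y'.
Proof.
have sub (k m : nat) : rank_boxes q i x y -> rank_boxes q i (x - k%:Z) (y - m%:Z).
  move=> xy; elim: k => [|k IH]; last first.
    by have /andP[+ _] := rank_boxes_pred IH; congr (is_true (rank_boxes _ _ _ _)); lia.
  elim: m => [|m IH]; first by rewrite !subr0.
  by have /andP[_] := rank_boxes_pred IH; congr (is_true (rank_boxes _ _ _ _)); lia.
by move=> xx yy /(sub `|x - x'|%N `|y - y'|%N); congr (is_true (rank_boxes _ _ _ _)); lia.
Qed.

(** If the box is present, then no removal of chips defeats the greedy player. When
    the opponent leaves the last cycle alone, either the box was there before and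
    one more chip may be spent, or it was just added and the congruence spares
    this chip. When the opponent plays [c > 0] chips on the last cycle, one new
    chip may be forced, and the box [c] rows below, which was there before in both
    cases, leaves room for it. *)
Lemma rank_boxes_greedy q s i (d : int) :
  rank_boxes q i (i%:Z - d + (chips_left s i)%:Z) ((chips_left s i)%:Z + 1) ->
  (greedy (fun j => q j - chips_coord s j) i)%:Z <= d - (chips_left s i)%:Z.
Proof.
elim: i d => [|i IH] d.
  have -> : chips_left s 0 = 0%N by rewrite /chips_left (eq_count (a2 := pred0)) ?count_pred0.
  by rewrite /=; lia.
set q' := fun j => _; set e := chips_left s i; set c := count (fun u => u.1 == i) s.
rewrite chips_leftS -/e -/c; have [c0|c_gt0] := posnP c.
  rewrite c0 addn0 /= => /orP[lam1|/and3P[lam1 _ sp]].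
    have := IH (d - 1); rewrite -/e.
    rewrite (_ : i%:Z - (d - 1) + e%:Z = i.+1%:Z - d + e%:Z); last by lia.
    by move/(_ lam1); rewrite -/q'; case: (special _ _ _) => /=; lia.
  have := IH d; rewrite -/e.
  rewrite (_ : i%:Z - d + e%:Z = i.+1%:Z - d + e%:Z - 1); last by lia.
  move/(_ lam1); rewrite -/q' le_eqVlt => /predU1P[gE|]; last first.
    by case: (special _ _ _) => /=; lia.
  suff -> : special q' i (greedy q' i) by rewrite addn0 gE.
  have se : chips_coord s i = - a i * e%:R.
    apply: chips_coord_avoid => u us; apply/negP => ui.
    by have : has (fun u => u.1 == i) s; [apply/hasP; exists u|rewrite has_count -/c c0].
  apply/asboolP; rewrite /q' gE.
  rewrite (_ : - a i * _ = - a i * (i%:Z - (i.+1%:Z - d + e%:Z) + (e%:Z + 1))%:~R - chips_coord s i).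
    by apply: congr_modB; [exact/asboolP|exact: congr_mod_refl].
  rewrite se -[e%:R]/((e%:Z)%:~R) -mulrBr -rmorphB; congr (_ * _%:~R); lia.
move=> /= lamS.
have lam1 : rank_boxes q i (i%:Z - (d - 1 - c%:Z) + e%:Z) (e%:Z + 1).
  by case/orP: lamS => [|/and3P[_ + _]]; apply: rank_boxes_le; lia.
by have := IH _ lam1; rewrite -/q' -/e; case: (special _ _ _) => /=; lia.
Qed.

(** If the box is missing, then one of the conditions of the growth rule fails, and
    this failure tells the opponent whether to play a chip on the last cycle. At
    most [r] chips are asked for, because the opponent may win before all of them
    are used. *)
Lemma not_rank_boxes_greedy q i (d : int) (r : nat) :
  ~~ rank_boxes q i (i%:Z - d + r%:Z) (r%:Z + 1) ->
  exists s, [/\ all (fun u => u.1 < i)%N s, (size s <= r)%N &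
    d - r%:Z < (greedy (fun j => q j - chips_coord s j) i)%:Z].
Proof.
have widen s i' : all (fun u => u.1 < i')%N s -> all (fun u => u.1 < i'.+1)%N s.
  by apply: sub_all => u ui; rewrite ltnS ltnW.
elim: i d r => [|i IH] d r; first by move=> /= lam0; exists [::]; split=> //; lia.
have block s : all (fun u => u.1 < i)%N s -> exists c : R,
    greedy (fun j => q j - chips_coord ((i, c) :: s) j) i.+1 =
    (greedy (fun j => q j - chips_coord s j) i).+1.
  move=> s_lt; set q' := fun j => q j - chips_coord s j.
  (* The coordinate is chosen half a turn away from the only one that would
     spare the greedy player a chip. *)
  exists (q' i + a i * (greedy q' i)%:R - l i / 2).
  rewrite /=; set q'' := fun j => _ - chips_coord (_ :: s) j.
  have -> : greedy q'' i = greedy q' i.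
    apply: congr_greedy => j ji; rewrite /q'' chips_coord_cons chip_coord_right// add0r.
    exact: congr_mod_refl.
  suff -> : special q'' i (greedy q' i) = false by rewrite addn1.
  apply/asboolP => -[k]; rewrite /q'' chips_coord_cons /chip_coord ltnn eqxx /q'.
  rewrite -[_%:~R]/(_%:R) => kE.
  have : (k + k)%:~R = 1 :> R.
    apply: (mulIf (lt0r_neq0 (l_gt0 i))); rewrite mul1r rmorphD mulrDl /= -kE /=.
    by field.
  by move/(@intr_inj R _ 1); lia.
rewrite /= negb_or => /andP[lam0]; rewrite 2!negb_and => /or3P[lam1|lam1|nsp].
- have [|s [s_lt s_r sd]] := IH d r; first by apply: contra lam1; congr (is_true (rank_boxes _ _ _ _)); lia.
  by exists s; split; [exact: widen|by []|apply: lt_le_trans sd _; lia].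
- have r_gt0 : (0 < r)%N.
    by rewrite lt0n; apply: contra lam1 => /eqP ->; rewrite rank_boxes_le0// orbC.
  have [|s [s_lt s_r sd]] := IH (d - 2) r.-1.
    by apply: contra lam1; congr (is_true (rank_boxes _ _ _ _)); lia.
  have [c cE] := block s s_lt; exists ((i, c) :: s); split.
  + by rewrite /= ltnSn widen.
  + by rewrite /=; lia.
  + by move: cE => /= ->; lia.
have [|s [s_lt s_r sd]] := IH (d - 1) r.
  by apply: contra lam0; congr (is_true (rank_boxes _ _ _ _)); lia.
(* With a chip to spare the opponent blocks the last cycle; otherwise all r
   chips lie to the left and the failing congruence is the relevant one. *)
have [sr|sr] := ltnP (size s) r.
  have [c cE] := block s s_lt; exists ((i, c) :: s); split.
  + by rewrite /= ltnSn widen.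
  + by rewrite /=; lia.
  + by move: cE => /= ->; lia.
exists s; split=> //; first exact: widen.
set q' := fun j => _ in sd *.
case: (ltP (d - r%:Z) (greedy q' i)%:Z) => [|gd]; first by case: (special _ _ _) => /=; lia.
have gE : (greedy q' i)%:Z = d - r%:Z by lia.
suff -> : special q' i (greedy q' i) = false by rewrite /=; lia.
apply: contraNF nsp => /asboolP; rewrite gE => sp; apply/asboolP.
have sE : chips_coord s i = - a i * (r%:Z)%:~R.
  rewrite chips_coord_avoid ?chips_left_all// => [|u /(allP s_lt)].
    by congr (_ * _%:R); lia.
  by rewrite neq_ltn => ->.
have := congr_modD sp (congr_mod_refl (l i) (chips_coord s i)).
rewrite /q' subrK sE -mulrDr -rmorphD; congr (congr_mod _ _ (_ * _%:~R)); lia.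
Qed.

(** The spare chips of the opponent are put at coordinate [0] of the last cycle,
    where they have no influence on the weights. *)
Lemma rank_boxesP q (g : nat) (d : int) (r : nat) : (0 < g)%N ->
  rank_boxes q g (g%:Z - d + r%:Z) (r%:Z + 1) <->
  forall s, all (fun u => u.1 < g)%N s -> size s = r ->
    (greedy (fun j => q j - chips_coord s j) g)%:Z <= d - r%:Z.
Proof.
move=> g0; split=> [lamP s s_lt s_r|rankP].
  by have := @rank_boxes_greedy q s g d; rewrite (chips_left_all s_lt) s_r; exact.
apply/negPn/negP => /not_rank_boxes_greedy[s [s_lt s_r]].
pose s' := s ++ nseq (r - size s) (g.-1, 0).
have s'_lt : all (fun u => u.1 < g)%N s'.
  by rewrite all_cat s_lt all_nseq /= prednK// leqnn orbT.
have := rankP s' s'_lt; rewrite size_cat size_nseq subnKC// => /(_ erefl).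
rewrite leNgt => /negP le_r lt_r; apply: le_r; move: lt_r.
rewrite (@congr_greedy _ (fun j => q j - chips_coord s' j))// => j jg.
rewrite /chips_coord big_cat /= big_nseq /chip_coord /=.
have -> : (if (j < g.-1)%N then 0 else if j == g.-1 then 0 else - a j) = 0 :> R.
  by case: ltngtP => //; lia.
rewrite [X in _ - (_ + X)](_ : _ = 0) ?addr0; first exact: congr_mod_refl.
by elim: (r - _)%N => //= k ->; rewrite addr0.
Qed.
End ChipGame.

(** * Ranks of divisors on a chain of cycles *)

Section ChainRank.
Context {R : realType} {n : nat} (C : chain R n).
Notation G := (chain_graph C).
Notation mp := (marked_point C).
Implicit Types (i k : 'I_n.+1) (D E : divisor G).

(** The growth process inducts on the number of cycles, hence numeric indices. *)
Definition nat_arc j : R := arc_len C (inord j).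
Definition nat_cycle j : R := cycle_len C (inord j).

Notation coord := (cycle_coord (C := C)).
Notation congr i := (congr_mod (cycle_len C i)).

Lemma cycle_len_gt0 i : 0 < cycle_len C i.
Proof. exact: lt_trans (arc_len_gt0 C i) (arc_len_lt C i). Qed.

Lemma cycle_coord_w i k : coord i (inl (w_vertex C k)) =
  if (k < i)%N then cycle_len C i - arc_len C i else 0.
Proof. by rewrite /cycle_coord /= addr0. Qed.

Lemma cycle_coord_v i k : coord i (inl (v_vertex C k)) =
  if (k <= i)%N then cycle_len C i - arc_len C i else 0.
Proof. by rewrite /cycle_coord !retract_v addr0. Qed.

Lemma cycle_coord_marked i : coord i mp = 0.
Proof. by rewrite cycle_coord_w ltnNge -ltnS ltn_ord. Qed.

Lemma chip_coord_cycle_len k c i p :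
  coord k p = c -> (forall i, i != k -> coord i p =
     if (k < i)%N then cycle_len C i - arc_len C i else 0) ->
  congr i (coord i p) (chip_coord nat_arc (k : nat, c) i).
Proof.
move=> kc ip; rewrite /chip_coord /= /nat_arc inord_val.
case: (eqVneq i k) => [->|ik]; first by rewrite ltnn kc eqxx; exact: congr_mod_refl.
rewrite ip// (_ : (i == k :> nat) = false); last exact/negbTE.
case: (ltngtP i k) => ik'; try exact: congr_mod_refl; last by rewrite (val_inj ik') eqxx in ik.
by exists 1; rewrite opprK subrK mul1r.
Qed.

Lemma cycle_edge_chip k b s i : 0 <= s <= len (inl (k, b) : edge G) ->
  let p := epoint (inl (k, b) : edge G) s in
  congr i (coord i p) (chip_coord nat_arc (k : nat, coord k p) i).
Proof.
move=> sP p; apply: chip_coord_cycle_len => // {}i ik.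
rewrite /p cycle_coord_epoint// /coord_shift.
have ki c : (inl (k, b) == inl (i, c) :> edge G) = false.
  by apply/eqP => -[/esym/eqP]; rewrite (negbTE ik).
rewrite !ki addr0; case: b {sP p ki} => /=; last exact: cycle_coord_w.
rewrite cycle_coord_v leq_eqVlt [(k == i :> nat)](_ : _ = false)//.
by rewrite eq_sym; exact/negbTE.
Qed.

Lemma point_chip (p : gpoint G) : exists2 u : nat * R, (u.1 < n.+1)%N &
  forall i, congr i (coord i p) (chip_coord nat_arc u i).
Proof.
case: p => [[k|k]|[[e s] sP]].
- exists (k : nat, coord k (inl (w_vertex C k))) => [|i]; first exact: ltn_ord.
  by apply: chip_coord_cycle_len => // j _; exact: cycle_coord_w.
- exists (val k : nat, coord (val k) (inl (v_vertex C (val k)))) => [|i].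
    exact: ltn_ord.
  have -> : inl (inr k) = inl (v_vertex C (val k)) :> gpoint G.
    congr inl; rewrite /v_vertex; case: insubP => [x _ /val_inj ->|] //.
    by rewrite (valP k).
  apply: chip_coord_cycle_len => // j jk; rewrite cycle_coord_v leq_eqVlt.
  by rewrite (_ : (val k == j :> nat) = false)// eq_sym; exact/negbTE.
have sP' : 0 <= s <= len e by case/andP: (sP) => /ltW -> /ltW.
rewrite -epoint_inner; case: e {sP} sP' => [[k b]|j] sP.
  exists (k : nat, coord k (epoint (inl (k, b) : edge G) s)) => [|i].
    exact: ltn_ord.
  exact: cycle_edge_chip.
have jE i : coord i (epoint (inr j : edge G) s) =
    coord i (inl (w_vertex C (lift ord_max (val j)))).
  by rewrite cycle_coord_epoint// /coord_shift /= addr0.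
exists (lift ord_max (val j) : nat, 0) => [|i]; first exact: ltn_ord.
by apply: chip_coord_cycle_len => [|k _]; rewrite jE cycle_coord_w ?ltnn.
Qed.

(** The coordinate of [cycle_point] is reduced into [0, l[, which moves it by a
    multiple of the length. *)
Lemma cycle_coord_point k c i :
  congr i (coord i (cycle_point C k c)) (chip_coord nat_arc (k : nat, c) i).
Proof.
have l0 := cycle_len_gt0 k; set l := cycle_len C k in l0.
pose s := c - (Num.floor (c / l))%:~R * l.
have /andP[s0 sl] : 0 <= s < l.
  have /andP[fl lf] := floor_itv (c / l); rewrite /s subr_ge0 -ler_pdivlMr// fl.
  by rewrite ltrBlDl -[X in _ + X]mul1r -mulrDl -ltr_pdivrMr// -[1]/(1%:~R) -rmorphD.
have tf : (inl (k, true) == inl (k, false) :> edge G) = false by apply/eqP => -[].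
suff [b [r [rP pE ps]]] : exists b, exists r, let e : edge G := inl (k, b) in
    [/\ 0 <= r <= len e, cycle_point C k c = epoint e r & coord k (epoint e r) = s].
  rewrite pE; apply: congr_mod_trans (cycle_edge_chip i rP) _; rewrite ps.
  rewrite /chip_coord /=; case: ltnP => _; first exact: congr_mod_refl.
  case: eqP => [/val_inj ->|_]; last exact: congr_mod_refl.
  by exists (- Num.floor (c / l)); rewrite /s -/l; ring.
rewrite /cycle_point -/l -/s; case: leP => sla.
  exists false, s; have sP : 0 <= s <= len (inl (k, false) : edge G) by rewrite s0.
  split=> //; rewrite cycle_coord_epoint// /coord_shift eqxx.
  by rewrite cycle_coord_w ltnn add0r.
exists true, (s - (l - arc_len C k)).
have sP : 0 <= s - (l - arc_len C k) <= len (inl (k, true) : edge G).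
  by rewrite subr_ge0 ltW //= lerBlDr subrKC ltW.
split=> //; rewrite cycle_coord_epoint// /coord_shift eqxx tf.
by rewrite cycle_coord_v leqnn ltrBlDr subrKC -/l sl //; ring.
Qed.

(** The Abel-Jacobi theorem for chains of cycles. *)
Lemma lin_equivP D D' : lin_equiv D D' <->
  deg D = deg D' /\ forall i, congr i (cycle_weight i D) (cycle_weight i D').
Proof.
split=> [DD'|[degE wE]].
  split=> [|i]; last by rewrite /congr_mod -cycle_weightB; exact: principal_chain_weight.
  case/principalE: (DD' : principal (D - D')) => f [h [_ _ hE]].
  by apply/eqP; rewrite -subr_eq0 -degB hE deg_hinge_div.
apply: chain_principal => [|i]; first by rewrite degB degE subrr.
by rewrite cycle_weightB; exact: wE.
Qed.

Definition nat_weight D j : R := cycle_weight (inord j) D.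
Notation greedy_chain := (greedy nat_cycle nat_arc).

Lemma effective_chips E : effective E -> exists s, [/\ (size s)%:Z = deg E,
  all (fun u => u.1 < n.+1)%N s &
  forall i, congr i (cycle_weight i E) (chips_coord nat_arc s i)].
Proof.
move=> E_ge0.
have /choice[chip chipP] (p : gpoint G) : exists u : nat * R, (u.1 < n.+1)%N /\
    forall i, congr i (coord i p) (chip_coord nat_arc u i).
  by have [u] := point_chip p; exists u.
exists (flatten [seq nseq `|coeff p E|%N (chip p) | p <- dom E]); split.
- rewrite size_flatten /shape -map_comp sumnE big_map -[in RHS](freeg_sumE E).
  rewrite !raddf_sum; apply: eq_bigr => p _ /=.
  by rewrite size_nseq degU gez0_abs.
- apply/allP => u /flattenP[s /mapP[p _ ->]].
  by rewrite mem_nseq => /andP[_ /eqP ->]; case: (chipP p).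
move=> i; rewrite /cycle_weight /weight /chips_coord big_flatten big_map.
apply: congr_mod_sum => p; rewrite -[in X in congr_mod _ X](gez0_abs (E_ge0 p)).
rewrite -pmulrn big_nseq; elim: `|_|%N => [|m IH].
  by rewrite mulr0n; exact: congr_mod_refl.
by rewrite mulrS; apply: congr_modD => //; case: (chipP p).
Qed.

Lemma chips_effective s : all (fun u => u.1 < n.+1)%N s -> exists E,
  [/\ effective E, deg E = (size s)%:Z &
  forall i, congr i (cycle_weight i E) (chips_coord nat_arc s i)].
Proof.
elim: s => [_|[k c] s IH /= /andP[kn /IH[E [E_ge0 degE wE]]]].
  exists 0; split=> [p||i]; rewrite ?coeff0 ?raddf0//.
  by rewrite /cycle_weight raddf0 /chips_coord big_nil; exact: congr_mod_refl.
exists (<< cycle_point C (Ordinal kn) c >> + E); split=> [p||i].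
- by rewrite coeffD coeffU mul1r addr_ge0 ?ler0n.
- by rewrite degD degU degE; lia.
rewrite /cycle_weight weightD weightU mulr1z chips_coord_cons.
by apply: congr_modD => //; exact: (cycle_coord_point (Ordinal kn)).
Qed.

Lemma nat_congr (q q' : nat -> R) :
  (forall i, congr i (q i) (q' i)) ->
  forall j, (j < n.+1)%N -> congr_mod (nat_cycle j) (q j) (q' j).
Proof. by move=> qq' j jn; have := qq' (inord j); rewrite inordK. Qed.

Lemma lin_equiv_effectiveP D :
  (exists2 D', effective D' & lin_equiv D D') <->
  (greedy_chain (nat_weight D) n.+1)%:Z <= deg D.
Proof.
have wE i : nat_weight D i = cycle_weight i D by rewrite /nat_weight inord_val.
split=> [[E E_ge0 /lin_equivP[degE DE]]|gD].
  have [s [s_size s_lt sE]] := effective_chips E_ge0; rewrite degE -s_size lez_nat.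
  apply/(effective_greedyP _ _ _ _ (ltn0Sn n)); exists s; split=> //.
  apply: nat_congr => i; rewrite wE; exact: congr_mod_trans (DE i) (sE i).
have [d dE] : exists d : nat, deg D = d%:Z by exists `|deg D|%N; lia.
rewrite dE lez_nat in gD.
have [s [s_size s_lt sE]] := (effective_greedyP _ _ _ _ (ltn0Sn n)).2 gD.
have [E [E_ge0 degE sEE]] := chips_effective s_lt; exists E => //.
apply/lin_equivP; split=> [|i]; first by rewrite degE s_size.
apply: congr_mod_trans (congr_mod_sym (sEE i)).
by have := sE i (ltn_ord i); rewrite /nat_cycle wE inord_val.
Qed.

(** Removing an effective divisor amounts to removing its chips, and conversely the
    opponent in the chip game can be given points of the graph. *)
Lemma rank_geqP D (r : nat) : rank_geq D r <->
  rank_boxes nat_cycle nat_arc (nat_weight D) n.+1 (n.+1%:Z - deg D + r%:Z) (r%:Z + 1).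
Proof.
have nl j : 0 < nat_cycle j by exact: cycle_len_gt0.
have grE E s : (forall i, congr i (cycle_weight i E) (chips_coord nat_arc s i)) ->
    greedy_chain (nat_weight (D - E)) n.+1 =
    greedy_chain (fun j => nat_weight D j - chips_coord nat_arc s j) n.+1.
  move=> sE; apply: congr_greedy; apply: nat_congr => i.
  rewrite /nat_weight inord_val cycle_weightB.
  by apply: congr_modB; [exact: congr_mod_refl|exact: sE].
rewrite (rank_boxesP nat_arc nl _ _ _ (ltn0Sn n)); split=> [rP s s_lt s_r|rP E E_ge0 degE].
  have [E [E_ge0 degE sE]] := chips_effective s_lt.
  rewrite s_r in degE; have /lin_equiv_effectiveP := rP E E_ge0 degE.
  by rewrite (grE _ _ sE) degB degE.
have [s [s_size s_lt sE]] := effective_chips E_ge0.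
apply/lin_equiv_effectiveP; rewrite (grE _ _ sE) degB degE; apply: rP => //.
by move: s_size; rewrite degE => -[].
Qed.

Lemma rank_geq_le D (r r' : nat) : (r <= r')%N -> rank_geq D r' -> rank_geq D r.
Proof. by move=> rr' /rank_geqP lamr'; apply/rank_geqP; apply: rank_boxes_le lamr'; lia. Qed.

(** Removing [r] times the marked point leaves degree [deg D - r], which cannot be
    negative for a class with an effective representative. *)
Lemma rank_geq_deg D (r : nat) : rank_geq D r -> r%:Z <= deg D.
Proof.
move=> rP; have [] := rP << r%:Z *g mp >>.
- by move=> p; rewrite coeffU mulr_ge0 ?ler0n.
- by rewrite degU.
move=> E E_ge0 /lin_equivP[+ _]; rewrite degB degU.
have [s [<- _ _]] := effective_chips E_ge0; lia.
Qed.

(** The set of ranks that are reached is a bounded initial segment of the integers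
    that contains the negative ones, so its maximum exists and decides membership. *)
Lemma bn_rankP D (r : nat) : (r%:Z <= bn_rank D) <-> rank_geq D r.
Proof.
have neg (m : int) : m < 0 -> rank_geq D m.
  move=> m0 E E_ge0 degE; have [s [sE _ _]] := effective_chips E_ge0; lia.
have [m mP] : exists m, rank_geq D m /\ forall j, rank_geq D j -> j <= m.
  have [r0|r0] := pselect (rank_geq D 0%N); last first.
    exists (-1); split=> [|[j|j] jP]; [exact: neg| |by rewrite NegzE; lia].
    by case: r0; apply: rank_geq_le jP.
  pose P j := `[< rank_geq D (j : nat) >].
  have exP : exists j, P j by exists 0%N; exact/asboolP.
  have leP j : P j -> (j <= `|deg D|)%N by move=> /asboolP/rank_geq_deg; lia.
  case: (ex_maxnP exP leP) => j /asboolP jP j_max; exists j; split=> // -[h|h] hP.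
    by have := j_max h (introT (asboolP _) hP); lia.
  by rewrite NegzE; lia.
have -> : bn_rank D = m.
  apply: xget_unique => // j [jP j_max]; apply/eqP; rewrite eq_le mP.2//.
  exact: j_max mP.1.
split=> [rm|]; last exact: mP.2.
case: m mP rm => [m|m] [mP _] rm; last by move: rm; rewrite NegzE; lia.
exact: rank_geq_le mP.
Qed.

(** A bridge of positive length adds both an edge and a vertex that is not glued, so
    that only the cycles count. *)
Lemma genus_chain : genus G = n.+1%:Z.
Proof.
rewrite /genus /= card_sum card_prod card_ord card_bool card_sum card_ord !card_sig.
have -> : #|[pred i | ~~ glued C i]| = #|[pred j | 0 < bridge_len C j]|.+1.
  rewrite -!sum1_card big_mkcond big_ord_recl inE {1}/glued unlift_none /=.
  rewrite add1n [in RHS]big_mkcond; congr _.+1; apply: eq_bigr => j _.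
  by rewrite !inE bridge_len_glued lt_def bridge_len_ge0 andbT.
by set b := #|_|; lia.
Qed.
End ChainRank.

(** * Torsion orders and displacement tableaux *)

Section Torsion.
Context {R : realType} {n : nat} (C : chain R n) (i : 'I_n.+1).
Let a := arc_len C i.
Let l := cycle_len C i.

Definition arc_multiple (k : int) := exists z : int, k%:~R * a = z%:~R * l.

Lemma arc_multipleB (k m : int) : arc_multiple k -> arc_multiple m -> arc_multiple (k - m).
Proof.
case=> z zE [y yE]; exists (z - y).
by rewrite !rmorphB !mulrBl zE yE.
Qed.

Lemma arc_multipleM (k m : int) : arc_multiple k -> arc_multiple (m * k).
Proof. by case=> z zE; exists (m * z); rewrite !rmorphM -!mulrA zE. Qed.

(** The integers [k] such that [k] times the arc is a multiple of the cycle form a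
    subgroup, generated by the torsion order: it is trivial in the irrational case,
    and otherwise division with remainder applies to its least positive element. *)
Lemma torsion_orderP :
  arc_multiple (torsion_order C i)%:Z /\
  forall k : int, arc_multiple k -> ((torsion_order C i)%:Z %| k)%Z.
Proof.
have l0 : l != 0 by rewrite lt0r_neq0 // cycle_len_gt0.
rewrite /torsion_order; set P := (X in xget _ X); case: asboolP => [[q qE]|irr].
- have [m Pm] : exists m, P m.
    have ex : exists m, (0 < m)%N && `[< arc_multiple m%:Z >].
      exists `|denq q|%N; rewrite absz_gt0 denq_neq0; apply/asboolP; exists (numq q).
      rewrite gez0_abs ?denq_ge0// /a qE mulrA; congr (_ * _).
      by rewrite /ratr mulrC divfK// intr_eq0 denq_neq0.
    case: (ex_minnP ex) => m /andP[m0 /asboolP mP] m_min; exists m; split=> //.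
    by move=> k k0 kP; apply: m_min; rewrite k0; exact/asboolP.
  have [m0 mP m_min] := xgetPex 0%N (ex_intro P m Pm).
  set t := xget 0%N P in m0 mP m_min *.
  split=> [//|k kP]; apply/dvdz_mod0P/eqP; rewrite -[_ == _]negbK.
  apply/negP => kt; have t0 : t%:Z != 0 by rewrite -lt0n in m0 *; lia.
  have k_ge0 := modz_ge0 k t0.
  have kmodP : arc_multiple `|(k %% t%:Z)%Z|%N%:Z.
    by rewrite gez0_abs// /modz; apply: arc_multipleB => //; exact: arc_multipleM.
  have := m_min `|(k %% t%:Z)%Z|%N; rewrite absz_gt0 kt => /(_ isT kmodP).
  have := ltz_mod k t0; lia.
split; first by exists 0; rewrite !mul0r.
move=> k [z zE]; rewrite dvd0z; apply/negPn/negP => k0; apply: irr.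
exists (z%:Q / k%:Q); rewrite rmorphM fmorphV /= !ratr_int.
have kR : k%:~R != 0 :> R by rewrite intr_eq0.
by apply: (mulfI kR); rewrite -/a zE -/l; field.
Qed.
End Torsion.

Section Tableaux.
Context {R : realType} {n : nat} (C : chain R n).
Notation G := (chain_graph C).
Notation mp := (marked_point C).
Notation congr i := (congr_mod (cycle_len C i)).
Notation boxesD D := (rank_boxes (nat_cycle C) (nat_arc C) (nat_weight D)).
Notation weight_on := (cycle_weight (C := C)).

Lemma in_boxes_gt0 la x y : in_boxes la x y -> (0 < x) && (0 < y).
Proof. by case/and4P; lia. Qed.

Lemma in_boxes_left la x y : in_boxes la x y -> 1 < x -> in_boxes la (x - 1) y.
Proof. by case/and4P => y1 yla x1 xla x2; apply/and4P; split; lia. Qed.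

Lemma in_boxes_below la x y : is_partition la ->
  in_boxes la x y -> 1 < y -> in_boxes la x (y - 1).
Proof.
move=> la_part /and4P[y1 yla x1 xla] y2; apply/and4P; split=> //; try lia.
apply: le_trans xla _; rewrite lez_nat.
have geq_trans : transitive geq by move=> p q r pq rp; exact: leq_trans rp pq.
by apply: (sorted_leq_nth geq_trans leqnn 0%N la_part); rewrite ?inE; lia.
Qed.

Lemma chain_specialP D (i : 'I_n.+1) (T : int) :
  special (nat_cycle C) (nat_arc C) (nat_weight D) i T <->
  congr i (weight_on i D) (- arc_len C i * T%:~R).
Proof.
rewrite /special /nat_cycle /nat_arc /nat_weight !inord_val.
by split=> [/asboolP|?] //; exact/asboolP.
Qed.

Lemma marked_weight i d : weight_on i << d *g mp >> = 0.
Proof. by rewrite /cycle_weight weightU cycle_coord_marked mul0rz. Qed.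

(** Multiples of the marked point have weight zero, so all the rank conditions on
    the class of [D] are read off the same weights. *)
Lemma Wset_rank_boxes D la : deg D = 0 ->
  (forall d' r' : int, in_boxes la (genus G - d' + r') (r' + 1) ->
     r' <= bn_rank (D + << d' *g mp >>)) <->
  (forall x y, in_boxes la x y -> boxesD D n.+1 x y).
Proof.
move=> D0.
have rankE d' (r : nat) : r%:Z <= bn_rank (D + << d' *g mp >>) <->
    boxesD D n.+1 (n.+1%:Z - d' + r%:Z) (r%:Z + 1).
  rewrite bn_rankP rank_geqP degD D0 degU add0r.
  suff -> : nat_weight (D + << d' *g mp >>) = nat_weight D by [].
  apply/funext => j; by rewrite /nat_weight cycle_weightD marked_weight addr0.
split=> [DP x y xy|DP d' r' xy].
  have /andP[x0 y0] := in_boxes_gt0 xy.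
  have [r yE] : exists r : nat, y = r%:Z + 1 by exists `|y - 1|%N; lia.
  have xE : x = n.+1%:Z - (n.+1%:Z + r%:Z - x) + r%:Z by lia.
  rewrite xE yE; apply/rankE/DP; rewrite genus_chain -xE -yE //.
case: r' xy => [r|r] xy; last by have := in_boxes_gt0 xy; rewrite NegzE; lia.
by apply/rankE/DP; rewrite -(genus_chain C).
Qed.

Definition torus_divisor (xi : 'I_n.+1 -> R) : divisor G :=
  \sum_i << coord_point C i (xi i) >> - << (n.+1)%:Z *g mp >>.

Lemma deg_torus_divisor xi : deg (torus_divisor xi) = 0.
Proof.
rewrite /torus_divisor degB degU raddf_sum /=.
under eq_bigr do rewrite degU.
by rewrite sumr_const card_ord natz subrr.
Qed.

(** The [i] points on the cycles to the left contribute [- a_i] each. *)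
Lemma torus_divisor_weight xi i :
  congr i (weight_on i (torus_divisor xi)) ((xi i - (i : nat)%:R) * arc_len C i).
Proof.
rewrite /torus_divisor cycle_weightB marked_weight subr0 /cycle_weight weight_sum.

apply: (@congr_mod_trans _ _ (\sum_(k < n.+1) chip_coord (nat_arc C) (k : nat, xi k * arc_len C k) i)).
  apply: congr_mod_sum => k; rewrite weightU mulr1z; exact: cycle_coord_point.
suff -> : \sum_(k < n.+1) chip_coord (nat_arc C) (k : nat, xi k * arc_len C k) i =
    (xi i - (i : nat)%:R) * arc_len C i by exact: congr_mod_refl.
rewrite (bigD1 i) //= mulrBl {1}/chip_coord ltnn eqxx; congr (_ + _) => /=.
transitivity (\sum_(k < n.+1 | (k < i)%N) - arc_len C i).
  rewrite big_mkcond [in RHS]big_mkcond; apply: eq_bigr => k _.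
  rewrite /chip_coord /nat_arc inord_val /=.
  rewrite (_ : (k != i) = (k != i :> nat))//.
  by case: ltngtP.
by rewrite (big_ord_narrow (ltnW (ltn_ord i))) sumr_const card_ord mulNrn mulr_natl.
Qed.

Lemma div_class_eq (D D' : divisor G) : lin_equiv D D' -> div_class D = div_class D'.
Proof.
case/lin_equivP => degE wE; apply/predeqP => E; split=> /lin_equivP[dE wDE];
  apply/lin_equivP; split=> [|i]; rewrite -?dE //.
  exact: congr_mod_trans (congr_mod_sym (wE i)) (wDE i).
exact: congr_mod_trans (wE i) (wDE i).
Qed.

(** By induction on the labels, each box has appeared once the cycle named by its
    label has been processed. *)
Lemma Tset_sub_Wset la t : is_partition la -> displacement_tableau C la t ->
  Tset C la t `<=` Wset mp la.
Proof.
move=> la_part [t_row t_col _] _ [xi xiP <-].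
exists (torus_divisor xi) => //; split; first exact: deg_torus_divisor.
apply/Wset_rank_boxes => [|x y xy]; first exact: deg_torus_divisor.
suff lamt k x' y' : in_boxes la x' y' -> (t x' y' < k)%N ->
    boxesD (torus_divisor xi) k x' y' by exact: lamt.
elim: k x' y' => // k IH {xy}x {}y xy; rewrite ltnS leq_eqVlt => /predU1P[tk|tk]; last first.
  by apply: rank_boxes_homo (IH _ _ xy tk).
have /andP[x0 y0] := in_boxes_gt0 xy.
rewrite -tk in IH *; rewrite /=; apply/orP; right; apply/and3P; split.
- case: (leP x 1) => x1; first by apply: rank_boxes_le0; apply/orP; left; lia.
  have xy' := in_boxes_left xy x1.
  by apply: (IH _ _ xy'); apply: (t_row _ _ _ xy' xy); lia.
- case: (leP y 1) => y1; first by apply: rank_boxes_le0; apply/orP; right; lia.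
  have xy' := in_boxes_below la_part xy y1.
  by apply: (IH _ _ xy'); apply: (t_col _ _ _ xy' xy); lia.
apply/chain_specialP; apply: congr_mod_trans (torus_divisor_weight _ _) _.
have [m mE] := xiP x y xy; have [[z zE] _] := torsion_orderP C (t x y).
exists (m * z); rewrite mE rmorphM -mulrA -zE !(rmorphD, rmorphB, rmorphN) /=.
by rewrite -!pmulrn; ring.
Qed.

(** The tableau records the step at which each box appears. *)
Lemma Wset_sub_Tset la : Wset mp la `<=`
  \bigcup_(t in [set t | displacement_tableau C la t]) Tset C la t.
Proof.
move=> _ [D [D0 /(Wset_rank_boxes _ D0) DP] <-].
pose t x y : 'I_n.+1 := inord (find (fun i => boxesD D i.+1 x y) (iota 0 n.+1)).
have tP x y : in_boxes la x y -> boxesD D (t x y).+1 x y && ~~ boxesD D (t x y) x y.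
  move=> xy; have /andP[x0 y0] := in_boxes_gt0 xy; rewrite /t; set P := fun i => _.
  have hasP : has P (iota 0 n.+1).
    by apply/hasP; exists n; rewrite ?mem_iota ?add0n ?leqnn//; exact: DP.
  have fn : (find P (iota 0 n.+1) < n.+1)%N by rewrite -[X in (_ < X)%N](size_iota 0) -has_find.
  rewrite inordK//; have := nth_find 0%N hasP; rewrite nth_iota// add0n => Pf.
  apply/andP; split; first exact: Pf.
  case fE : (find P (iota 0 n.+1)) => [|k] /=; first by lia.
  have := @before_find _ 0%N P (iota 0 n.+1) k; rewrite fE => /(_ (ltnSn k)).
  by rewrite nth_iota ?add0n => [/negbT//|]; rewrite fE in fn; lia.
have t_special x y : in_boxes la x y -> [/\ boxesD D (t x y) (x - 1) y,
    boxesD D (t x y) x (y - 1) &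
    congr (t x y) (weight_on (t x y) D) (- arc_len C (t x y) * ((t x y : nat)%:Z - x + y)%:~R)].
  move=> /tP/andP[/= /orP[->//|/and3P[lam1 lam2 sp]] _].
  by split=> //; exact/chain_specialP.
have t_lt x y x' y' : in_boxes la x y -> in_boxes la x' y' ->
    boxesD D (t x' y') x y -> (t x y < t x' y')%N.
  move=> /tP/andP[_ nlam] xy' lam'; rewrite ltnNge; apply: contra nlam => tt.
  exact: rank_boxes_homo lam'.
have t_tab : displacement_tableau C la t.
  split=> [x x' y xy xy' xx|x y y' xy xy' yy|x y x' y' xy xy' _ tE].
  - apply: t_lt => //; have [lam' _ _] := t_special _ _ xy'; apply: rank_boxes_le lam'; lia.
  - apply: t_lt => //; have [_ lam' _] := t_special _ _ xy'; apply: rank_boxes_le lam'; lia.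
  apply/eqP; rewrite eqz_mod_dvd; apply: (torsion_orderP C (t x y)).2.
  have [_ _ /congr_mod_sym c1] := t_special _ _ xy.
  have [_ _] := t_special _ _ xy'; rewrite -tE => c2.
  have [z zE] := congr_mod_trans c1 c2; exists z; rewrite -zE; ring.
exists t => //.
have /choice[xi xiP] (i : 'I_n.+1) : exists xi : R,
    congr i (weight_on i D) ((xi - (i : nat)%:R) * arc_len C i) /\
    forall x y, in_boxes la x y -> t x y = i -> exists k : int,
      xi = (x - y)%:~R + k%:~R * (torsion_order C i)%:R.
  have [[x [y [xy ti]]]|no] := pselect (exists x y, in_boxes la x y /\ t x y = i).
    (* All boxes with label i agree modulo the torsion order: any of them will do. *)
    exists (x - y)%:~R; split.
      have [_ _] := t_special _ _ xy; rewrite ti; congr (congr_mod _ _ _).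
      by rewrite !(rmorphD, rmorphB) /= -pmulrn; ring.
    move=> x' y' xy' ti'; have [_ _ tmod] := t_tab.
    have : (x - y = x' - y' %[mod (torsion_order C i)%:Z])%Z.
      have [[-> ->]//|ne] := pselect ((x, y) = (x', y')).
      by have := tmod _ _ _ _ xy xy' ne; rewrite ti ti'; exact.
    move/eqP; rewrite eqz_mod_dvd => /dvdzP[k kE]; exists k.
    by rewrite pmulrn -rmorphM -kE -rmorphD /= subrKC.
  exists (weight_on i D / arc_len C i + (i : nat)%:R); split.
    by rewrite addrK divfK ?lt0r_neq0 ?arc_len_gt0//; exact: congr_mod_refl.
  by move=> x y xy ti; case: no; exists x, y.
exists xi => [x y xy|]; first by have [_ /(_ x y xy erefl)] := xiP (t x y).
apply: div_class_eq; apply/lin_equivP; split=> [|i].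
  by rewrite D0; exact: deg_torus_divisor.
apply: congr_mod_trans (torus_divisor_weight _ _) _.
by apply: congr_mod_sym; case: (xiP i).
Qed.
End Tableaux.

Theorem theorem1p4 (R : realType) (n : nat) (C : chain R n) (la : seq nat)
    (hla : is_partition la) :
  Wset (marked_point C) la =
  \bigcup_(t in [set t | displacement_tableau C la t]) Tset C la t.
Proof.
apply/seteqP; split; first exact: Wset_sub_Tset.
by move=> X [t t_tab]; exact: Tset_sub_Wset.
Qed.
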